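(* For all $\epsilon>0$ there exists $d_0>1$ such that for all $d>d_0$ and all $\lambda\le(1-\epsilon)/d$, there exists $C=C(d)>0$ such that with probability $1-o(1)$ over the choice of $G\sim G(n,d/n)$, the mixing time of the Glauber dynamics for the hard-core model on $G$ with fugacity $\lambda$ is $O(n^C)$.
   Context: $G(n,d/n)$ is the Erdős–Rényi random graph with edge probability $d/n$. The hard-core model on $G$ with fugacity $\lambda>0$ is the distribution on independent sets $I$ of $G$ with $\mu(I)\propto\lambda^{|I|}$. Its (heat-bath) Glauber dynamics: from the current independent set, choose a uniformly random vertex $v$; if some neighbor of $v$ is in the set, $v$ is made unoccupied; otherwise $v$ is made occupied with probability $\lambda/(1+\lambda)$ and unoccupied otherwise; other vertices are unchanged. The mixing time is the minimum number of steps after which, from the worst initial state, the distribution is within total variation distance $1/4$ of $\mu$. *)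

(* Defs.v *)
From HB Require Import structures.
From mathcomp Require Import all_boot all_order all_algebra.
From mathcomp Require Import all_classical all_reals all_analysis.
Set Implicit Arguments. Unset Strict Implicit. Unset Printing Implicit Defensive.
Import Order.TTheory GRing.Theory Num.Theory.
Local Open Scope ring_scope.

Section HardCore.
Variable R : realType.

(* Vertex set 'I_n; a simple graph is a set of 2-element subsets (edges). *)
Definition pairs (n : nat) : {set {set 'I_n}} := [set e : {set 'I_n} | #|e| == 2]%N.

Definition gnp_weight (n : nat) (p : R) (E : {set {set 'I_n}}) : R :=
  if E \subset pairs n then p ^+ #|E| * (1 - p) ^+ (#|pairs n| - #|E|) else 0.

Definition gnp_prob (n : nat) (p : R) (A : pred {set {set 'I_n}}) : R :=
  \sum_(E : {set {set 'I_n}} | A E) gnp_weight p E.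

Definition adj (n : nat) (E : {set {set 'I_n}}) (u v : 'I_n) : bool := [set u; v] \in E.

Definition is_indep (n : nat) (E : {set {set 'I_n}}) (I : {set 'I_n}) : bool :=
  [forall u in I, forall v in I, ~~ adj E u v].

Definition hc_weight (n : nat) (E : {set {set 'I_n}}) (lam : R) (I : {set 'I_n}) : R :=
  if is_indep E I then lam ^+ #|I| else 0.

Definition hc_mu (n : nat) (E : {set {set 'I_n}}) (lam : R) (I : {set 'I_n}) : R :=
  hc_weight E lam I / \sum_(J : {set 'I_n}) hc_weight E lam J.

Definition glauber_P (n : nat) (E : {set {set 'I_n}}) (lam : R) (I J : {set 'I_n}) : R :=
  n%:R^-1 * \sum_(v : 'I_n)
    (if [exists u in I, adj E u v] then (J == I :\ v)%:R
     else lam / (1 + lam) * (J == v |: I)%:R + 1 / (1 + lam) * (J == I :\ v)%:R).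

Definition glauber_step (n : nat) (E : {set {set 'I_n}}) (lam : R)
  (f : {set 'I_n} -> R) (J : {set 'I_n}) : R :=
  \sum_(I : {set 'I_n}) f I * glauber_P E lam I J.

Definition glauber_dist (n : nat) (E : {set {set 'I_n}}) (lam : R) (t : nat)
  (I0 : {set 'I_n}) : {set 'I_n} -> R :=
  iter t (glauber_step E lam) (fun J => (J == I0)%:R).

Definition tv_dist (n : nat) (f g : {set 'I_n} -> R) : R :=
  2^-1 * \sum_(J : {set 'I_n}) `|f J - g J|.

(* "mixing time <= T": the mixing time is the least t such that from every
   initial independent set the t-step law is within TV 1/4 of mu; it is <= T
   iff some t <= T has this property. *)
Definition mixing_time_le (n : nat) (E : {set {set 'I_n}}) (lam : R) (T : R) : Prop :=
  exists t : nat, t%:R <= T /\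
    forall I0 : {set 'I_n}, is_indep E I0 ->
      tv_dist (glauber_dist E lam t I0) (hc_mu E lam) <= 4^-1.

End HardCore.

(* Main.v *)
Require Import Defs.
From HB Require Import structures.
From mathcomp Require Import all_boot all_order all_algebra.
From mathcomp Require Import ring lra.
From mathcomp Require Import reals sequences exp.
Set Implicit Arguments. Unset Strict Implicit. Unset Printing Implicit Defensive.
Import Order.TTheory GRing.Theory Num.Theory.
Local Open Scope ring_scope.

(** Let [p = lam / (1 + lam)], so that [p * d < 1].  By disagreement percolation,
    the total influence of a vertex [u] in any induced subgraph of [G] is at most
    the mean size of the cluster of [u] in site percolation of parameter [p] on
    [G].  Averaged over [G ~ G(n, d/n)] too, this cluster is a subcritical
    exploration, so its size has a bounded exponential moment; with Jensen and
    Markov, with high probability all total influences are at most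
    [eta = O(log n)].

    By spectral independence, revealing a uniformly random vertex among [k]
    costs a factor [1 - eta / k] of the variance.  Revealing all but
    [m ~ n / (6 d)] vertices thus costs only [exp (O(eta n / m)) = n ^ O(d)], and
    what remains is a random graph whose clusters have size [C] with
    [E 2 ^ C = O(1)].  On a cluster of size [C] the Poincare constant is at most
    [3 * 2 ^ C], uniformly in [lam], by comparison with the empty configuration.
    This gives a polynomial Poincare constant for the dynamics, hence polynomial
    mixing.  All conditionings are on sets of occupied and empty vertices, which
    in the hard-core model amount to passing to an induced subgraph. *)

(** * Bernoulli random subsets *)

Section Bernoulli.
Variables (R : realFieldType) (T : finType).
Implicit Types (P Q A B O : {set T}) (p c : R) (g h : {set T} -> R).

(** One expectation operator for both sources of randomness: vertex subsets (site percolation) and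
    subsets of [pairs n] (the random graph). *)
Definition bern P p g : R :=
  \sum_(O : {set T} | O \subset P) p ^+ #|O| * (1 - p) ^+ (#|P| - #|O|) * g O.

Lemma big_subsets_setD1 (F : {set T} -> R) P x : x \in P ->
  \sum_(O : {set T} | O \subset P) F O =
  \sum_(O : {set T} | O \subset P :\ x) F O +
  \sum_(O : {set T} | O \subset P :\ x) F (x |: O).
Proof.
move=> xP; rewrite (bigID (fun O : {set T} => x \in O)) /= addrC; congr (_ + _).
  by apply: eq_bigl => O; rewrite subsetD1.
rewrite (reindex_onto (fun O => x |: O) (fun O => O :\ x)) /=; last first.
  by move=> O /andP[_ xO]; rewrite setD1K.
apply: eq_bigl => O; rewrite subUset sub1set xP setU11 andbT /= subsetD1.
case xO: (x \in O) => /=; rewrite ?andbF ?andbT.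
  apply/negP => /andP[_ /eqP oe].
  by move: (setD11 x (x |: O)); rewrite oe xO.
by rewrite setU1K ?xO// eqxx andbT.
Qed.

Lemma bern_setD1 P p g x : x \in P ->
  bern P p g = p * bern (P :\ x) p (fun O => g (x |: O))
               + (1 - p) * bern (P :\ x) p g.
Proof.
move=> xP; rewrite /bern (big_subsets_setD1 _ xP) addrC !mulr_sumr.
have cP : #|P| = #|P :\ x|.+1 by rewrite (cardsD1 x P) xP.
congr (_ + _); apply: eq_bigr => O; rewrite subsetD1 => /andP[OP xO].
  by rewrite cardsU1 xO cP add1n subSS exprS; ring.
have : (#|O| <= #|P :\ x|)%N by apply: subset_leq_card; rewrite subsetD1 OP.
by move=> le; rewrite cP subSn// exprS; ring.
Qed.

Lemma bern_set0 p g : bern set0 p g = g set0.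
Proof.
rewrite /bern (eq_bigl (pred1 set0)); last by move=> O; rewrite subset0.
by rewrite big_pred1_eq !cards0 !expr0 !mul1r.
Qed.

Lemma eq_bern P p g h : (forall O, O \subset P -> g O = h O) ->
  bern P p g = bern P p h.
Proof. by move=> gh; apply: eq_bigr => O OP; rewrite gh. Qed.

Lemma bern_cst P p c : bern P p (fun=> c) = c.
Proof.
elim: {P}#|P| {-2}P (erefl #|P|) => [|k IHk] P cP.
  by move/eqP: cP; rewrite cards_eq0 => /eqP ->; rewrite bern_set0.
have [x xP] : exists x, x \in P by apply/set0Pn; rewrite -card_gt0 cP.
rewrite (bern_setD1 _ _ xP) !IHk; first by ring.
by move: cP; rewrite (cardsD1 x P) xP => -[].
Qed.

Lemma bernD P p g h : bern P p (fun O => g O + h O) = bern P p g + bern P p h.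
Proof. by rewrite /bern -big_split; apply: eq_bigr => O _; rewrite mulrDr. Qed.

Lemma bernZ P p c g : bern P p (fun O => c * g O) = c * bern P p g.
Proof. by rewrite /bern mulr_sumr; apply: eq_bigr => O _; rewrite mulrCA. Qed.

Lemma bern_sum (I : Type) (r : seq I) (a : pred I) P p (G : I -> {set T} -> R) :
  bern P p (fun O => \sum_(i <- r | a i) G i O) = \sum_(i <- r | a i) bern P p (G i).
Proof.
by rewrite /bern exchange_big /=; apply: eq_bigr => O _; rewrite mulr_sumr.
Qed.

Lemma le_bern P p g h : 0 <= p <= 1 -> (forall O, O \subset P -> g O <= h O) ->
  bern P p g <= bern P p h.
Proof.
move=> /andP[p0 p1] gh; apply: ler_sum => O OP.
apply: ler_wpM2l; last exact: gh.
by rewrite mulr_ge0// exprn_ge0// subr_ge0.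
Qed.

Lemma bern_ge0 P p g : 0 <= p <= 1 -> (forall O, O \subset P -> 0 <= g O) ->
  0 <= bern P p g.
Proof. by move=> p01 g0; rewrite -(bern_cst P p 0); apply: le_bern. Qed.

Lemma bern_setU A B p g : [disjoint A & B] ->
  bern (A :|: B) p g = bern A p (fun O1 => bern B p (fun O2 => g (O1 :|: O2))).
Proof.
elim: {A}#|A| {-2}A (erefl #|A|) g => [|k IHk] A cA g AB.
  move/eqP: cA; rewrite cards_eq0 => /eqP ->; rewrite bern_set0 set0U.
  by apply: eq_bern => O _; rewrite set0U.
have [x xA] : exists x, x \in A by apply/set0Pn; rewrite -card_gt0 cA.
have xB : x \notin B by have := disjointFr AB xA => ->.
have cA' : k = #|A :\ x| by move: cA; rewrite (cardsD1 x A) xA => -[].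
have AB' : [disjoint A :\ x & B] by apply: disjointWl AB; exact: subsetDl.
have xAB : x \in A :|: B by rewrite inE xA.
have eAB : (A :|: B) :\ x = A :\ x :|: B.
  by apply/setP => y; rewrite !inE; case: eqP => //= ->; rewrite (negbTE xB).
rewrite (bern_setD1 _ _ xAB) (bern_setD1 _ _ xA) eAB !IHk//.
by congr (_ * _ + _); apply: eq_bern => O _; apply: eq_bern => O2 _; rewrite setUA.
Qed.

Lemma bern_p1 P g : bern P 1 g = g P.
Proof.
rewrite /bern (bigD1 P) //= subnn expr0 expr1n !mul1r big1 ?addr0// => O /andP[OP ne].
have : (0 < #|P| - #|O|)%N.
  by rewrite subn_gt0; apply: proper_card; rewrite properEneq ne.
by case: (_ - _)%N => // k _; rewrite subrr exprS mul0r mulr0 mul0r.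
Qed.

Lemma bern_expr_card P p c :
  bern P p (fun O => c ^+ #|O|) = (1 + p * (c - 1)) ^+ #|P|.
Proof.
elim: {P}#|P| {-2}P (erefl #|P|) => [|k IHk] P cP.
  by move/eqP: cP; rewrite cards_eq0 => /eqP ->; rewrite bern_set0 cards0 !expr0.
have [x xP] : exists x, x \in P by apply/set0Pn; rewrite -card_gt0 cP.
have cP' : k = #|P :\ x| by move: cP; rewrite (cardsD1 x P) xP => -[].
rewrite (bern_setD1 _ _ xP) cP exprS IHk -?cP'//.
rewrite (@eq_bern _ _ _ (fun O => c * c ^+ #|O|)) ?bernZ ?IHk -?cP'//; first by ring.
by move=> O; rewrite subsetD1 => /andP[_ xO]; rewrite cardsU1 xO add1n exprS.
Qed.

Lemma bern_expr_cardI P Q p c :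
  bern P p (fun O => c ^+ #|O :&: Q|) = (1 + p * (c - 1)) ^+ #|P :&: Q|.
Proof.
have d : [disjoint P :&: Q & P :\: Q].
  rewrite -setI_eq0; apply/eqP/setP => y; rewrite !inE.
  by case: (y \in Q); rewrite ?andbF.
rewrite -{1}(setID P Q) (bern_setU _ _ d) -bern_expr_card.
apply: eq_bern => O1; rewrite subsetI => /andP[_ O1Q].
rewrite -[RHS](bern_cst (P :\: Q) p); apply: eq_bern => O2.
rewrite subsetD => /andP[_ O2Q]; rewrite setIUl (setIidPl O1Q).
by move: O2Q; rewrite -setI_eq0 => /eqP ->; rewrite setU0.
Qed.

End Bernoulli.

(** * Clusters of site percolation *)

Section Cluster.
Variables (T : finType).
Implicit Types (e : rel T) (O X Y : {set T}).

Definition inrel e O : rel T := fun a b => [&& a \in O, b \in O & e a b].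

(** [O] is the set of open vertices; seeds in [X] outside [O] are closed and generate nothing. When
    everything is open and [X] is a singleton, this is a connected component. *)
Definition cluster e O X : {set T} :=
  [set w | [exists x in X :&: O, connect (inrel e O) x w]].

Definition nbhd e (x : T) : {set T} := [set y | e x y].

Lemma clusterP e O X w :
  reflect (exists2 x, x \in X :&: O & connect (inrel e O) x w) (w \in cluster e O X).
Proof. by rewrite inE; apply: (iffP exists_inP). Qed.

Lemma mem_cluster e O X x : x \in X -> x \in O -> x \in cluster e O X.
Proof. by move=> xX xO; apply/clusterP; exists x; rewrite ?inE ?xX. Qed.

Lemma cluster_sub e O X : cluster e O X \subset O.
Proof.
apply/subsetP => w /clusterP[x]; rewrite inE => /andP[_ xO] /connectP[s].
elim: s x xO => [|y s IHs] x xO /= => [_ -> //|/andP[/and3P[_ yO _] +]].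
exact: IHs.
Qed.

Lemma cluster_step e O X a b : a \in cluster e O X -> b \in O -> e a b ->
  b \in cluster e O X.
Proof.
move=> aC bO eab; have aO := subsetP (cluster_sub e O X) _ aC.
have /clusterP[x xX xa] := aC; apply/clusterP; exists x => //.
by apply: connect_trans xa (connect1 _); rewrite /inrel aO bO.
Qed.

(** The induction principle for clusters; the inclusions below rest on it. *)
Lemma cluster_min e O X Y : X :&: O \subset Y ->
  (forall a b, a \in Y -> b \in O -> e a b -> b \in Y) -> cluster e O X \subset Y.
Proof.
move=> XY step; apply/subsetP => w /clusterP[x /(subsetP XY) xY /connectP[s]].
elim: s x xY => [|y s IHs] x xY /= => [_ -> //|/andP[/and3P[_ yO exy] +]].
by apply: IHs; exact: step exy.
Qed.

Lemma clusterS e O O' X X' : O \subset O' -> X \subset X' ->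
  cluster e O X \subset cluster e O' X'.
Proof.
move=> OO XX; apply: cluster_min.
  apply/subsetP => x; rewrite inE => /andP[xX xO].
  by apply: mem_cluster; [exact: (subsetP XX)|exact: (subsetP OO)].
by move=> a b aC bO; apply: cluster_step => //; exact: (subsetP OO).
Qed.

Lemma cluster0 e O X : [disjoint X & O] -> cluster e O X = set0.
Proof.
move=> d; apply/eqP; rewrite -subset0; apply: cluster_min.
  by rewrite subset0; rewrite setI_eq0.
by move=> a b; rewrite inE.
Qed.

(** Exploration step: once [x] is open, it leaves the graph and its neighbours become seeds. This
    inclusion bounds exponential moments of clusters from above; the reverse one serves to bound
    influences by clusters. *)
Lemma cluster_explore_sub e O X x :
  cluster e (x |: O) X \subset x |: cluster e O (X :|: nbhd e x).
Proof.
apply: cluster_min => [|a b].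
  apply/subsetP => y; rewrite !in_setI !in_setU1 => /andP[yX /orP[->//|yO]].
  by rewrite mem_cluster ?orbT// inE yX.
rewrite !in_setU1 => /orP[/eqP ->|aC] /orP[->//|bO] eab; apply/orP; right.
  by apply: mem_cluster => //; rewrite !inE eab orbT.
exact: cluster_step eab.
Qed.

Lemma cluster_explore_sup e O X x : x \in X ->
  x |: cluster e O (X :|: nbhd e x) \subset cluster e (x |: O) X.
Proof.
move=> xX; have xC : x \in cluster e (x |: O) X by rewrite mem_cluster ?setU11.
rewrite subUset sub1set xC /=; apply: cluster_min => [|a b aC bO].
  apply/subsetP => y; rewrite in_setI in_setU => /andP[yXN yO].
  have yO' : y \in x |: O by rewrite in_setU1 yO orbT.
  case/orP: yXN => [yX|]; first exact: mem_cluster.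
  by rewrite inE; exact: cluster_step xC yO'.
by apply: cluster_step aC _; rewrite in_setU1 bO orbT.
Qed.

Lemma cluster_sym e O x y : symmetric e -> x \in O ->
  y \in cluster e O [set x] -> cluster e O [set x] \subset cluster e O [set y].
Proof.
move=> es xO yC; have yO := subsetP (cluster_sub _ _ _) _ yC.
apply: cluster_min => [|a b]; last exact: cluster_step.
apply/subsetP => z; rewrite !inE => /andP[/eqP -> _].
apply/existsP; exists y; rewrite !inE eqxx yO /=.
move/clusterP: yC => [x']; rewrite !inE => /andP[/eqP -> _].
rewrite (@sym_connect_sym _ (inrel e O))// => u v; rewrite /inrel es.
by rewrite andbCA.
Qed.

End Cluster.

(** * The hard-core measure on induced subgraphs *)

Section HardCoreMeasure.
Variables (R : realFieldType) (T : finType) (e : rel T) (lam : R).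
Hypotheses (e_sym : symmetric e) (e_irr : irreflexive e) (lam_gt0 : 0 < lam).
Implicit Types (W J U P Q X Y : {set T}) (u v x : T) (f g h : {set T} -> R) (c : R).

Definition indep J := [forall u in J, forall v in J, ~~ e u v].

Definition hcw J : R := if indep J then lam ^+ #|J| else 0.

Definition hcS W g : R := \sum_(J : {set T} | J \subset W) hcw J * g J.

Definition hcZ W : R := hcS W (fun=> 1).

Definition hcE W g : R := hcS W g / hcZ W.

Definition hcV W g : R := hcE W (fun J => g J ^+ 2) - hcE W g ^+ 2.

(** The vertices still undetermined when [u] is occupied; when [u] is empty, they are [W :\ u]. Both
    are induced subgraphs again. *)
Definition cut W u : {set T} := W :\ u :\: nbhd e u.

Definition occ W u : R := lam * hcZ (cut W u) / hcZ W.

Definition pin u g : {set T} -> R := fun J => g (u |: J).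

Definition ind v J : R := (v \in J)%:R.

(* [hcD W v g] is the expected conditional variance of [g] given all
   coordinates but [v]. *)
Definition hcD W v g : R :=
  if v \in W then
    lam / (1 + lam) * hcS (cut W v) (fun J => (g (v |: J) - g J) ^+ 2) / hcZ W
  else 0.

Let lam_ge0 : 0 <= lam. Proof. exact: ltW. Qed.

Lemma indepP J : reflect {in J &, forall u v, ~~ e u v} (indep J).
Proof.
apply: (iffP forall_inP) => H u; last by move=> uJ; apply/forall_inP => v; exact: H.
by move=> v uJ; move/forall_inP: (H _ uJ); exact.
Qed.

Lemma hcw_ge0 J : 0 <= hcw J.
Proof. by rewrite /hcw; case: ifP => // _; exact: exprn_ge0. Qed.

Lemma hcw0 : hcw set0 = 1.
Proof.
rewrite /hcw cards0 expr0; case: indepP => // H; exfalso; apply: H => u.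
by rewrite inE.
Qed.

Lemma hcw_setU1 u J : u \notin J ->
  hcw (u |: J) = if [disjoint nbhd e u & J] then lam * hcw J else 0.
Proof.
move=> uJ; rewrite /hcw cardsU1 uJ add1n exprS.
have -> : indep (u |: J) = [disjoint nbhd e u & J] && indep J.
  apply/indepP/andP => [H|[d /indepP H] a b].
    split; last first.
      by apply/indepP => a b aJ bJ; apply: H; rewrite !inE ?aJ ?bJ orbT.
    rewrite -setI_eq0; apply/eqP/setP => y; rewrite !inE.
    apply/negbTE/negP => /andP[euy yJ]; move: (H u y); rewrite !inE eqxx yJ orbT euy.
    by move=> /(_ isT isT).
  have nu y : y \in J -> ~~ e u y.
    by move=> yJ; move: (disjointFl d yJ); rewrite inE => ->.
  rewrite !in_setU1 => /orP[/eqP ->|aJ] /orP[/eqP ->|bJ]; rewrite ?e_irr ?nu//.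
    by rewrite e_sym nu.
  exact: H.
by case: [disjoint _ & _] => //=; case: ifP => _; rewrite ?mulr0.
Qed.

Lemma in_cut W u x : (x \in cut W u) = [&& ~~ e u x, x != u & x \in W].
Proof. by rewrite !inE. Qed.

Lemma cut_sub W u : cut W u \subset W.
Proof. by apply/subsetP => x; rewrite in_cut => /and3P[]. Qed.

Lemma cut_subD1 W u : cut W u \subset W :\ u.
Proof. by apply/subsetP => x; rewrite in_cut !inE => /and3P[_ -> ->]. Qed.

Lemma eq_hcS W g h : (forall J, J \subset W -> g J = h J) -> hcS W g = hcS W h.
Proof. by move=> gh; apply: eq_bigr => J JW; rewrite gh. Qed.

(** Deletion recursion: an occupied [u] contributes the factor [lam] and forces its neighbours to be
    empty. *)
Lemma hcS_split W u g : u \in W ->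
  hcS W g = hcS (W :\ u) g + lam * hcS (cut W u) (pin u g).
Proof.
move=> uW; rewrite /hcS (big_subsets_setD1 _ uW) mulr_sumr; congr (_ + _).
rewrite [RHS]big_mkcond [LHS]big_mkcond; apply: eq_bigr => J _.
rewrite /cut (subsetD _ (W :\ u)) !subsetD1 (disjoint_sym (mem J)).
case: ifP => //= /andP[JW uJ]; rewrite hcw_setU1//.
by case: ifP => //= _; rewrite ?mul0r// mulrA.
Qed.

Lemma hcS_sum (I : Type) (r : seq I) (a : pred I) W (G : I -> {set T} -> R) :
  hcS W (fun J => \sum_(i <- r | a i) G i J) = \sum_(i <- r | a i) hcS W (G i).
Proof.
by rewrite /hcS exchange_big /=; apply: eq_bigr => O _; rewrite mulr_sumr.
Qed.

Lemma hcSD W g h : hcS W (fun J => g J + h J) = hcS W g + hcS W h.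
Proof. by rewrite /hcS -big_split; apply: eq_bigr => O _; rewrite mulrDr. Qed.

Lemma hcSZ W c g : hcS W (fun J => c * g J) = c * hcS W g.
Proof. by rewrite /hcS mulr_sumr; apply: eq_bigr => O _; rewrite mulrCA. Qed.

Lemma le_hcS W g h : (forall J, J \subset W -> g J <= h J) -> hcS W g <= hcS W h.
Proof. by move=> gh; apply: ler_sum => J JW; rewrite ler_wpM2l ?hcw_ge0 ?gh. Qed.

Lemma hcS_ge0 W g : (forall J, J \subset W -> 0 <= g J) -> 0 <= hcS W g.
Proof. by move=> g0; apply: sumr_ge0 => J JW; rewrite mulr_ge0 ?hcw_ge0 ?g0. Qed.

Lemma hcS_mono W W' g : W \subset W' -> (forall J, 0 <= g J) -> hcS W g <= hcS W' g.
Proof.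
move=> WW g0; rewrite /hcS [leLHS]big_mkcond [leRHS]big_mkcond; apply: ler_sum => J _.
have [JW|] := boolP (J \subset W); first by rewrite (subset_trans JW WW).
by case: ifP => // _ _; rewrite mulr_ge0 ?hcw_ge0.
Qed.

Lemma hcS_set0 g : hcS set0 g = g set0.
Proof.
rewrite /hcS (eq_bigl (pred1 set0)); last by move=> O; rewrite subset0.
by rewrite big_pred1_eq hcw0 mul1r.
Qed.

Lemma hcZ_gt0 W : 0 < hcZ W.
Proof.
apply: (@lt_le_trans _ _ (hcZ set0)); first by rewrite /hcZ hcS_set0.
by apply: hcS_mono; rewrite ?sub0set.
Qed.

Let hcZ_neq0 W : hcZ W != 0. Proof. by rewrite gt_eqF ?hcZ_gt0. Qed.

Lemma hcZ_split W u : u \in W -> hcZ W = hcZ (W :\ u) + lam * hcZ (cut W u).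
Proof. by move=> uW; rewrite /hcZ (hcS_split _ uW). Qed.

Lemma eq_hcE W g h : (forall J, J \subset W -> g J = h J) -> hcE W g = hcE W h.
Proof. by move=> gh; rewrite /hcE (eq_hcS gh). Qed.

Lemma hcE_sum (I : Type) (r : seq I) (a : pred I) W (G : I -> {set T} -> R) :
  hcE W (fun J => \sum_(i <- r | a i) G i J) = \sum_(i <- r | a i) hcE W (G i).
Proof. by rewrite /hcE hcS_sum mulr_suml. Qed.

Lemma hcED W g h : hcE W (fun J => g J + h J) = hcE W g + hcE W h.
Proof. by rewrite /hcE hcSD mulrDl. Qed.

Lemma hcEZ W c g : hcE W (fun J => c * g J) = c * hcE W g.
Proof. by rewrite /hcE hcSZ mulrA. Qed.

Lemma hcE_cst W c : hcE W (fun=> c) = c.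
Proof.
rewrite (@eq_hcE _ _ (fun=> c * 1)) ?hcEZ; last by move=> J _; rewrite mulr1.
by rewrite /hcE -/(hcZ W) divff ?mulr1.
Qed.

Lemma le_hcE W g h : (forall J, J \subset W -> g J <= h J) -> hcE W g <= hcE W h.
Proof. by move=> gh; rewrite ler_wpM2r ?invr_ge0 ?(ltW (hcZ_gt0 _)) ?le_hcS. Qed.

Lemma hcE_ge0 W g : (forall J, J \subset W -> 0 <= g J) -> 0 <= hcE W g.
Proof. by move=> g0; rewrite -(hcE_cst W 0); exact: le_hcE. Qed.

Lemma occ_ge0 W u : 0 <= occ W u.
Proof. by rewrite divr_ge0 ?mulr_ge0 ?(ltW (hcZ_gt0 _)). Qed.

(** The bound is the occupation probability of an isolated vertex; neighbours can only lower it, as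
    [hcZ (cut W u) <= hcZ (W :\ u)]. *)
Lemma occ_le W u : u \in W -> occ W u <= lam / (1 + lam).
Proof.
move=> uW; have l1 : 0 < 1 + lam by rewrite addr_gt0.
rewrite ler_pdivrMr ?hcZ_gt0// [leRHS]mulrAC ler_pdivlMr// -mulrA ler_wpM2l//.
rewrite (hcZ_split uW) mulrDr mulr1 (mulrC lam) lerD2r.
by apply: hcS_mono => //; exact: cut_subD1.
Qed.

Lemma hcE_split W u g : u \in W ->
  hcE W g = occ W u * hcE (cut W u) (pin u g) + (1 - occ W u) * hcE (W :\ u) g.
Proof.
move=> uW.
have -> : 1 - occ W u = hcZ (W :\ u) / hcZ W.
  by rewrite /occ -{1}(@divff _ (hcZ W))// -mulrBl {1}(hcZ_split uW) addrK.
rewrite /hcE (hcS_split _ uW) /occ; field.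
by rewrite !hcZ_neq0.
Qed.

Lemma hcVE W g : hcV W g = hcE W (fun J => (g J - hcE W g) ^+ 2).
Proof.
rewrite (@eq_hcE _ _ (fun J => g J ^+ 2 + (- 2 * hcE W g * g J + hcE W g ^+ 2))).
  by rewrite !hcED hcEZ hcE_cst /hcV; ring.
by move=> J _; ring.
Qed.

Lemma hcV_ge0 W g : 0 <= hcV W g.
Proof. by rewrite hcVE; apply: hcE_ge0 => J _; exact: sqr_ge0. Qed.

Lemma sqr_hcE_le W g : hcE W g ^+ 2 <= hcE W (fun J => g J ^+ 2).
Proof. by rewrite -subr_ge0; exact: hcV_ge0. Qed.

Lemma hcV_le_dist W g c : hcV W g <= hcE W (fun J => (g J - c) ^+ 2).
Proof.
rewrite (@eq_hcE _ (fun J => (g J - c) ^+ 2)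
   (fun J => g J ^+ 2 + (- 2 * c * g J + c ^+ 2))); last by move=> J _; ring.
rewrite !hcED hcEZ hcE_cst /hcV.
have := sqr_ge0 (hcE W g - c); nra.
Qed.

Definition gap W u g := hcE (cut W u) (pin u g) - hcE (W :\ u) g.

(** Law of total variance with respect to the state of [u]; the last term is the variance of the
    conditional mean, which takes two values. *)
Lemma hcV_split W u g : u \in W ->
  hcV W g = occ W u * hcV (cut W u) (pin u g) + (1 - occ W u) * hcV (W :\ u) g
            + occ W u * (1 - occ W u) * gap W u g ^+ 2.
Proof. by move=> uW; rewrite /hcV /gap !(hcE_split _ uW) /pin; ring. Qed.

Lemma hcD_ge0 W v g : 0 <= hcD W v g.
Proof.
rewrite /hcD; case: ifP => // _.
apply: divr_ge0 (ltW (hcZ_gt0 _)); apply: mulr_ge0.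
  by rewrite divr_ge0 ?addr_ge0.
by apply: hcS_ge0 => J _; exact: sqr_ge0.
Qed.

(** Total expectation over the state of [u]. If [u] and [v] are adjacent, an occupied [u] blocks
    [v], and the first term vanishes because [v] is not in [cut W u]. *)
Lemma hcD_split W u v g : u \in W -> u != v ->
  hcD W v g = occ W u * hcD (cut W u) v (pin u g) + (1 - occ W u) * hcD (W :\ u) v g.
Proof.
move=> uW uv.
have -> : 1 - occ W u = hcZ (W :\ u) / hcZ W.
  by rewrite /occ -{1}(@divff _ (hcZ W))// -mulrBl {1}(hcZ_split uW) addrK.
have l1 : 1 + lam != 0 by rewrite gt_eqF// addr_gt0.
rewrite /hcD in_cut in_setD1 eq_sym uv /=.
case: ifP => vW; rewrite ?andbF ?andbT; last by ring.
have e1 : cut W v :\ u = cut (W :\ u) v.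
  apply/setP => x; rewrite in_setD1 !in_cut in_setD1.
  by case: (e v x); case: (x == u); case: (x == v).
have [euv|neuv] := boolP (e u v) => /=.
  have -> : cut W v = cut (W :\ u) v.
    rewrite -e1; apply/setP => x; rewrite !inE; case: (eqVneq x u) => //= ->.
    by rewrite e_sym euv.
  rewrite /occ; field.
  by rewrite !hcZ_neq0 l1.
have ucv : u \in cut W v by rewrite in_cut e_sym neuv uv.
rewrite (hcS_split _ ucv) e1.
have -> : cut (cut W v) u = cut (cut W u) v.
  apply/setP => x; rewrite !in_cut.
  by case: (e u x); case: (e v x); case: (x == u); case: (x == v).
rewrite (@eq_hcS _ (pin u _) (fun J => (pin u g (v |: J) - pin u g J) ^+ 2)).
  rewrite /occ; field.
  by rewrite !hcZ_neq0 l1.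
by move=> J _; rewrite /pin setUCA.
Qed.

(** * Total influences and disagreement percolation *)

Definition infl P Q : R := \sum_(v : T) `|hcE P (ind v) - hcE Q (ind v)|.

Lemma inflC P Q : infl P Q = infl Q P.
Proof. by apply: eq_bigr => v _; rewrite distrC. Qed.

Lemma hcE_ind_notin W v : v \notin W -> hcE W (ind v) = 0.
Proof.
move=> vW; rewrite -(hcE_cst W 0); apply: eq_hcE => J JW; rewrite /ind.
by case: (boolP (v \in J)) => // /(subsetP JW); rewrite (negbTE vW).
Qed.

Lemma hcE_ind W v : v \in W -> hcE W (ind v) = occ W v.
Proof.
move=> vW; rewrite (hcE_split _ vW) (@hcE_ind_notin (W :\ v)) ?setD11//.
rewrite (@eq_hcE _ _ (fun=> 1)) ?hcE_cst; last by move=> J _; rewrite /pin /ind setU11.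
by ring.
Qed.

(** Condition [Q] on the state of [x]. The site [x] itself contributes [occ Q x], since it is absent
    from [P]; the other sites follow from the triangle inequality. *)
Lemma infl_split P Q x : x \in Q -> x \notin P ->
  infl P Q <= occ Q x * (1 + infl P (cut Q x)) + (1 - occ Q x) * infl P (Q :\ x).
Proof.
move=> xQ xP; have q0 := occ_ge0 Q x.
have q1 : occ Q x <= 1.
  by apply: le_trans (occ_le xQ) _; rewrite ler_pdivrMr ?addr_gt0// mul1r lerDr.
have -> : occ Q x * (1 + infl P (cut Q x)) + (1 - occ Q x) * infl P (Q :\ x) =
    \sum_v (occ Q x * ((v == x)%:R + `|hcE P (ind v) - hcE (cut Q x) (ind v)|)
            + (1 - occ Q x) * `|hcE P (ind v) - hcE (Q :\ x) (ind v)|).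
  rewrite big_split /= -!mulr_sumr big_split /= -/(infl _ _) -/(infl _ _).
  by rewrite (bigD1 x)//= eqxx big1 ?addr0// => v /negbTE ->.
apply: ler_sum => v _; case: (eqVneq v x) => [->|vx].
  rewrite (hcE_ind_notin xP) (hcE_ind xQ) sub0r normrN ger0_norm//.
  rewrite mulrDr mulr1 -addrA lerDl addr_ge0// mulr_ge0// subr_ge0//.
rewrite add0r (hcE_split _ xQ).
rewrite (@eq_hcE (cut Q x) (pin x _) (ind v)); last first.
  by move=> J _; rewrite /pin /ind in_setU1 (negbTE vx).
set a := hcE P _; set b := hcE _ _; set c := hcE _ _; move: (occ Q x) q0 q1 => q q0 q1.
have -> : a - (q * b + (1 - q) * c) = q * (a - b) + (1 - q) * (a - c) by ring.
apply: le_trans (ler_normD _ _) _; rewrite !normrM (ger0_norm q0).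
by rewrite -subr_ge0 in q1; rewrite (ger0_norm q1).
Qed.

(** Disagreement percolation, by induction on [Y]. Reveal a vertex [x] where the two sets differ: if
    it is empty, this discrepancy disappears; if it is occupied, its neighbours may become new ones.
    As [x] is occupied with probability at most [lam / (1 + lam)], site percolation explored from
    [X] dominates. *)
Lemma infl_le_cluster Y P Q X : P \subset Y -> Q \subset Y ->
  P :\: Q \subset X -> Q :\: P \subset X ->
  infl P Q <= bern Y (lam / (1 + lam)) (fun O => #|cluster e O X|%:R).
Proof.
have l1 : 0 < 1 + lam by rewrite addr_gt0.
set p := lam / (1 + lam).
have p01 : 0 <= p <= 1.
  by rewrite divr_ge0 ?(ltW l1)//= ler_pdivrMr// mul1r lerDr.
elim: {Y}#|Y| {-2}Y (erefl #|Y|) P Q X => [|k IHk] Y cY P Q X PY QY PQ QP.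
  move/eqP: cY; rewrite cards_eq0 => /eqP Y0; move: PY QY.
  rewrite Y0 !subset0 => /eqP -> /eqP ->; rewrite /infl big1 ?bern_ge0// => v _.
  by rewrite subrr normr0.
(* The influence is symmetric and vanishes for equal sets, so the discrepancy may be taken on the
   side of [Q]. *)
wlog [x xQ xP] : P Q PY QY PQ QP / exists2 x, x \in Q & x \notin P.
  have [-> _|] := eqVneq P Q.
    by rewrite /infl big1 ?bern_ge0// => v _; rewrite subrr normr0.
  rewrite eqEsubset negb_and => /orP[|] /subsetPn [x x1 x2] H.
    by rewrite inflC; apply: H => //; exists x.
  by apply: H => //; exists x.
have xY := subsetP QY _ xQ; have xX : x \in X by rewrite (subsetP QP)// inE xP.
have cY' : #|Y :\ x| = k by move: cY; rewrite (cardsD1 x Y) xY => -[].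
have PY' : P \subset Y :\ x by rewrite subsetD1 PY.
apply: le_trans (infl_split xQ xP) _.
have D1 : infl P (cut Q x) <= bern (Y :\ x) p (fun O => #|cluster e O (X :|: nbhd e x)|%:R).
  apply: IHk => //.
  - by apply: subset_trans (cut_subD1 _ _) (setSD _ QY).
  - apply/subsetP => y; rewrite in_setD in_cut !inE => /andP[+ yP].
    rewrite !negb_and !negbK; case/or3P => [->|/eqP yx|yQ]; rewrite ?orbT//.
      by rewrite yx (negbTE xP) in yP.
    by rewrite (subsetP PQ) // inE yQ.
  - apply/subsetP => y; rewrite in_setD in_cut => /andP[yP /and3P[_ _ yQ]].
    by rewrite inE (subsetP QP)// inE yP.
have D2 : infl P (Q :\ x) <= bern (Y :\ x) p (fun O => #|cluster e O X|%:R).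
  apply: IHk => //.
  - exact: setSD.
  - apply/subsetP => y; rewrite !inE negb_and negbK => /andP[/orP[/eqP yx|yQ] yP].
      by rewrite yx (negbTE xP) in yP.
    by rewrite (subsetP PQ) // inE yQ.
  - apply/subsetP => y; rewrite !inE => /and3P[yP _ yQ].
    by rewrite (subsetP QP)// inE yP.
have le21 : bern (Y :\ x) p (fun O => #|cluster e O X|%:R) <=
    bern (Y :\ x) p (fun O => #|cluster e O (X :|: nbhd e x)|%:R).
  by apply: le_bern => // O _; rewrite ler_nat subset_leq_card// clusterS// subsetUl.
have main : p * (1 + bern (Y :\ x) p (fun O => #|cluster e O (X :|: nbhd e x)|%:R))
    + (1 - p) * bern (Y :\ x) p (fun O => #|cluster e O X|%:R) <=
    bern Y p (fun O => #|cluster e O X|%:R).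
  rewrite (bern_setD1 _ _ xY) lerD2r ler_wpM2l//; first by case/andP: p01.
  rewrite -{1}(bern_cst (Y :\ x) p 1) -bernD; apply: le_bern => // O.
  rewrite subsetD1 => /andP[_ xO]; rewrite addrC natr1 ler_nat.
  apply: leq_trans (subset_leq_card (cluster_explore_sup e O xX)).
  rewrite cardsU1.
  have -> : x \notin cluster e O (X :|: nbhd e x).
    by apply/negP => /(subsetP (cluster_sub _ _ _)); rewrite (negbTE xO).
  by rewrite add1n.
apply: le_trans main.
have q0 := occ_ge0 Q x; have qp := occ_le xQ; rewrite -/p in qp.
set a := bern _ _ _ in D1 le21 *; set b := bern _ _ _ in D2 le21 *.
set q := occ Q x in q0 qp *.
have p1 : 0 <= 1 - p by rewrite subr_ge0; case/andP: p01.
have h1 : q * infl P (cut Q x) <= q * a by rewrite ler_wpM2l.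
have h2 : (1 - q) * infl P (Q :\ x) <= (1 - q) * b.
  by rewrite ler_wpM2l// subr_ge0; apply: le_trans qp _; rewrite -subr_ge0.
(* Raising the weight from [q] to [p] increases the bound, since more seeds give [b <= a]. *)
have h3 : 0 <= (p - q) * (1 + a - b).
  by rewrite mulr_ge0 ?subr_ge0//; lra.
lra.
Qed.

(** ** Spectral independence *)

Lemma hcE_mul_ind W u g : u \in W ->
  hcE W (fun J => g J * ind u J) - hcE W g * occ W u
  = occ W u * (1 - occ W u) * gap W u g.
Proof.
move=> uW; rewrite !(hcE_split _ uW) /gap.
rewrite (@eq_hcE (cut W u) (pin u (fun J => g J * ind u J)) (pin u g)); last first.
  by move=> J _; rewrite /pin /ind setU11 mulr1.
rewrite (@eq_hcE (W :\ u) (fun J => g J * ind u J) (fun=> 0)) ?hcE_cst; first by ring.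
move=> J; rewrite subsetD1 /ind => /andP[_ /negbTE ->]; exact: mulr0.
Qed.

Lemma occ_le1 W u : u \in W -> occ W u <= 1.
Proof.
move=> uW; apply: le_trans (occ_le uW) _.
by rewrite ler_pdivrMr ?addr_gt0// mul1r lerDr.
Qed.

(** An absolute row sum of the covariance matrix of the occupation variables; the summand [1] is the
    diagonal entry. *)
Lemma sum_cov_ind_le W u : u \in W ->
  \sum_(v in W) `|hcE W (fun J => ind v J * ind u J) - occ W v * occ W u|
  <= occ W u * (1 - occ W u) * (1 + infl (cut W u) (W :\ u)).
Proof.
move=> uW; have q0 := occ_ge0 W u; have q1 := occ_le1 uW.
have q2 : 0 <= occ W u * (1 - occ W u) by rewrite mulr_ge0// subr_ge0.
apply: (@le_trans _ _ (\sum_(v : T) occ W u * (1 - occ W u) *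
   ((v == u)%:R + `|hcE (cut W u) (ind v) - hcE (W :\ u) (ind v)|))); last first.
  rewrite -mulr_sumr ler_wpM2l// big_split /= (bigD1 u)//= eqxx.
  by rewrite big1 ?addr0// => v /negbTE ->.
rewrite [leLHS]big_mkcond; apply: ler_sum => v _; case: ifP => vW; last first.
  by rewrite mulr_ge0// addr_ge0.
rewrite -(hcE_ind vW) (hcE_mul_ind _ uW) normrM (ger0_norm q2) ler_wpM2l// /gap.
have [->|vu] := eqVneq v u.
  rewrite (@eq_hcE (cut W u) (pin _ _) (fun=> 1)); last first.
    by move=> J _; rewrite /pin /ind setU11.
  rewrite hcE_cst (@hcE_ind_notin (W :\ u)) ?setD11//.
  by rewrite subr0 normr1 lerDl.
rewrite (@eq_hcE (cut W u) (pin _ _) (ind v)) ?add0r// => J _.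
by rewrite /pin /ind in_setU1 (negbTE vu).
Qed.

(* Testing the variance of [g - h / eta], where [h] is the linear function
   with the coefficients [gap W u g], against [0]. *)
Lemma spectral_independence W g (eta : R) : 0 < eta ->
  (forall u, u \in W -> 1 + infl (cut W u) (W :\ u) <= eta) ->
  \sum_(u in W) occ W u * (1 - occ W u) * gap W u g ^+ 2 <= eta * hcV W g.
Proof.
move=> eta0 Heta; set Q := \sum_(u in W) _.
pose h J := \sum_(u in W) gap W u g * ind u J.
have covE f : hcE W (fun J => f J * h J) - hcE W f * hcE W h =
    \sum_(u in W) gap W u g * (occ W u * (1 - occ W u) * gap W u f).
  rewrite (@eq_hcE W _ (fun J => \sum_(u in W) gap W u g * (f J * ind u J))); last first.
    by move=> J _; rewrite /h mulr_sumr; apply: eq_bigr => u _; rewrite mulrCA.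
  rewrite !hcE_sum mulr_sumr -sumrB; apply: eq_bigr => u uW.
  by rewrite !hcEZ -(hcE_mul_ind _ uW) (hcE_ind uW); ring.
have covgh : hcE W (fun J => g J * h J) - hcE W g * hcE W h = Q.
  by rewrite covE; apply: eq_bigr => u _; ring.
pose c u v := hcE W (fun J => ind v J * ind u J) - occ W v * occ W u.
have c_sym u v : c u v = c v u.
  by rewrite /c (mulrC (occ W v)); congr (_ - _); apply: eq_hcE => J _; rewrite mulrC.
(* Schur test: this variance is a quadratic form in the symmetric matrix [c], bounded through
   [2xy <= x^2 + y^2] by the absolute row sums of [c]. *)
have varh : hcE W (fun J => h J ^+ 2) - hcE W h ^+ 2 <= eta * Q.
  rewrite !expr2 (@eq_hcE W _ (fun J => h J * h J)) ?covE//.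
  have -> : \sum_(u in W) gap W u g * (occ W u * (1 - occ W u) * gap W u h) =
      \sum_(u in W) \sum_(v in W) gap W u g * gap W v g * c u v.
    apply: eq_bigr => u uW; rewrite -(hcE_mul_ind _ uW).
    rewrite (@eq_hcE W _ (fun J => \sum_(v in W) gap W v g * (ind v J * ind u J))); last first.
      by move=> J _; rewrite /h mulr_suml; apply: eq_bigr => v _; rewrite mulrA.
    rewrite !hcE_sum mulr_suml -sumrB mulr_sumr; apply: eq_bigr => v vW.
    by rewrite !hcEZ /c (hcE_ind vW); ring.
  apply: (@le_trans _ _ (\sum_(u in W) \sum_(v in W)
      (2^-1 * (gap W u g ^+ 2 * `|c u v|) + 2^-1 * (gap W v g ^+ 2 * `|c u v|)))).
    apply: ler_sum => u uW; apply: ler_sum => v vW.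
    have := ler_norm (c u v); have := lerNnormlW (lexx `|c u v|).
    have := sqr_ge0 (gap W u g + gap W v g); have := sqr_ge0 (gap W u g - gap W v g).
    move: (gap W u g) (gap W v g) (c u v) `|c u v| => x y z t; nra.
  under eq_bigr do rewrite big_split /=.
  rewrite big_split /= (exchange_big _ _ _ _ _ (fun u v => 2^-1 * (gap W v g ^+ 2 * `|c u v|))) /=.
  have -> : \sum_(j in W) \sum_(i in W) 2^-1 * (gap W j g ^+ 2 * `|c i j|) =
     \sum_(j in W) \sum_(i in W) 2^-1 * (gap W j g ^+ 2 * `|c j i|).
    by apply: eq_bigr => j _; apply: eq_bigr => i _; rewrite c_sym.
  rewrite -big_split /= /Q mulr_sumr; apply: ler_sum => u uW.
  rewrite -big_split /=.
  have half : 2^-1 + 2^-1 = 1 :> R by field.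
  under eq_bigr do rewrite -mulrDl half mul1r.
  rewrite -mulr_sumr.
  rewrite mulrA (mulrC _ (gap W u g ^+ 2)) ler_wpM2l ?sqr_ge0//.
  apply: le_trans (sum_cov_ind_le uW) _; rewrite mulrC.
  by rewrite ler_wpM2r ?Heta// mulr_ge0 ?occ_ge0// subr_ge0 occ_le1.
(* With [V] the variance of [g], this gives [0 <= eta^2 V - 2 eta Q + eta Q], to be divided by
   [eta]. *)
have := hcV_ge0 W (fun J => eta * g J - h J).
have -> : hcV W (fun J => eta * g J - h J) =
   eta ^+ 2 * hcV W g - 2 * eta * Q + (hcE W (fun J => h J ^+ 2) - hcE W h ^+ 2).
  rewrite /hcV -covgh.
  rewrite (@eq_hcE W (fun J => eta * g J - h J) (fun J => eta * g J + -1 * h J)); last first.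
    by move=> J _; rewrite mulN1r.
  rewrite (@eq_hcE W (fun J => _ ^+ 2) (fun J => eta ^+ 2 * g J ^+ 2 +
     (- 2 * eta * (g J * h J) + h J ^+ 2))); last by move=> J _; ring.
  by rewrite !hcED !hcEZ; ring.
move=> pos; rewrite -(ler_pM2l eta0).
move: varh pos; set vh := _ - _; move=> varh pos; lra.
Qed.

(** * Factorization over vertex sets with no edge between them *)

Lemma cut_setU W W' v : v \in W -> [disjoint W & W'] ->
  (forall a b, a \in W -> b \in W' -> ~~ e a b) -> cut (W :|: W') v = cut W v :|: W'.
Proof.
move=> vW d n; have vW' : v \notin W' by rewrite (disjointFr d vW).
apply/setP => y; rewrite !inE; case: eqP => [->|_]; first by rewrite (negbTE vW') !andbF.
have [yW'|] := boolP (y \in W'); last by rewrite !orbF.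
by rewrite !orbT n.
Qed.

Lemma hcS_setU W W' g : [disjoint W & W'] ->
  (forall a b, a \in W -> b \in W' -> ~~ e a b) ->
  hcS (W :|: W') g = hcS W' (fun J' => hcS W (fun J => g (J :|: J'))).
Proof.
elim: {W}#|W| {-2}W (leqnn #|W|) g => [|k IHk] W cW g d nadj.
  move: cW; rewrite leqn0 cards_eq0 => /eqP ->; rewrite set0U.
  by apply: eq_hcS => J' _; rewrite hcS_set0 set0U.
have [->|[x xW]] := set_0Vmem W.
  by rewrite set0U; apply: eq_hcS => J' _; rewrite hcS_set0 set0U.
have xW' : x \notin W' by rewrite (disjointFr d xW).
have cW' : (#|W :\ x| <= k)%N by move: cW; rewrite (cardsD1 x W) xW.
have e1 : (W :|: W') :\ x = W :\ x :|: W'.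
  by apply/setP => y; rewrite !inE; case: eqP => //= ->; rewrite (negbTE xW').
have xWW : x \in W :|: W' by rewrite inE xW.
rewrite (hcS_split _ xWW) e1 (cut_setU xW d nadj) !IHk//.
- rewrite -hcSZ -hcSD; apply: eq_hcS => J' _; rewrite [RHS](hcS_split _ xW).
  by congr (_ + lam * _); apply: eq_hcS => J _; rewrite /pin setUA.
- by apply: leq_trans cW'; exact/subset_leq_card/cut_subD1.
- by apply: disjointWl d; exact: cut_sub.
- by move=> a b /(subsetP (cut_sub _ _)); exact: nadj.
- by apply: disjointWl d; exact: subsetDl.
- by move=> a b; rewrite inE => /andP[_]; exact: nadj.
Qed.

Lemma hcZ_setU W W' : [disjoint W & W'] ->
  (forall a b, a \in W -> b \in W' -> ~~ e a b) ->
  hcZ (W :|: W') = hcZ W * hcZ W'.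
Proof.
move=> d n; rewrite /hcZ (hcS_setU _ d n) -hcSZ; apply: eq_hcS => J _.
by rewrite mulr1.
Qed.

Lemma hcE_setU W W' g : [disjoint W & W'] ->
  (forall a b, a \in W -> b \in W' -> ~~ e a b) ->
  hcE (W :|: W') g = hcE W' (fun J' => hcE W (fun J => g (J :|: J'))).
Proof.
move=> d n; rewrite /hcE (hcS_setU _ d n) (hcZ_setU d n).
under [in RHS]eq_hcS do rewrite mulrC.
by rewrite hcSZ invfM; ring.
Qed.

(** ** Poincare inequalities *)

Definition diffS W v g : R := hcS (cut W v) (fun J => (g (v |: J) - g J) ^+ 2).

Lemma diffS_ge0 W v g : 0 <= diffS W v g.
Proof. by apply: hcS_ge0 => J _; exact: sqr_ge0. Qed.

(** Remove the vertices one by one. By [(a + b)^2 <= 2 a^2 + 2 b^2], adding [x] costs a factor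
    [1 + 2 lam <= 2] and a local term at [x]. The factor [lam] kept in that term makes the bound
    uniform as [lam] tends to 0. *)
Lemma hcS_sqr_dist_le W g : lam <= 2^-1 ->
  hcS W (fun J => (g J - g set0) ^+ 2)
  <= 2 ^+ #|W| * \sum_(v in W) 2 * lam * diffS W v g.
Proof.
move=> l2; elim: {W}#|W| {-2}W (erefl #|W|) => [|k IHk] W cW.
  move/eqP: cW; rewrite cards_eq0 => /eqP ->.
  by rewrite hcS_set0 subrr expr0n big_set0 mulr0.
have [x xW] : exists x, x \in W by apply/set0Pn; rewrite -card_gt0 cW.
have cW' : #|W :\ x| = k by move: cW; rewrite (cardsD1 x W) xW => -[].
have := IHk _ cW'; rewrite cW' cW (hcS_split _ xW) (big_setD1 x xW) /=.
set G := fun J => _; set s := \sum_(v in W :\ x) _; set s' := \sum_(v in W :\ x) _.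
move=> IH.
have ss : s <= s'.
  apply: ler_sum => v _; rewrite ler_wpM2l ?mulr_ge0//.
  apply: hcS_mono => [|J]; last exact: sqr_ge0.
  by apply/subsetP => y; rewrite !in_cut in_setD1 => /and3P[-> -> /andP[_ ->]].
have s0 : 0 <= s by apply: sumr_ge0 => v _; rewrite !mulr_ge0 ?diffS_ge0.
have G0 : 0 <= hcS (W :\ x) G by apply: hcS_ge0 => J _; exact: sqr_ge0.
have c1 : hcS (cut W x) (pin x G) <= 2 * hcS (W :\ x) G + 2 * diffS W x g.
  apply: (@le_trans _ _ (2 * hcS (cut W x) G + 2 * diffS W x g)).
    rewrite -!hcSZ -hcSD; apply: le_hcS => J _; rewrite /pin /G.
    have := sqr_ge0 ((g J - g set0) - (g (x |: J) - g J)); nra.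
  rewrite lerD2r ler_wpM2l//; apply: hcS_mono (cut_subD1 _ _) _ => J.
  exact: sqr_ge0.
have d0 := diffS_ge0 W x g.
have pk : 1 <= 2 ^+ k :> R by apply: exprn_ege1; rewrite ler1n.
apply: (@le_trans _ _ (2 * hcS (W :\ x) G + 2 * lam * diffS W x g)).
  have : lam * hcS (cut W x) (pin x G) <=
     lam * (2 * hcS (W :\ x) G + 2 * diffS W x g) by rewrite ler_wpM2l.
  have : 0 <= (2^-1 - lam) * hcS (W :\ x) G by rewrite mulr_ge0// subr_ge0.
  lra.
have h1 : 2 ^+ k * s <= 2 ^+ k * s' by rewrite ler_wpM2l// exprn_ge0.
have h2 : 1 * (2 * lam * diffS W x g) <= 2 ^+ k.+1 * (2 * lam * diffS W x g).
  rewrite ler_wpM2r ?mulr_ge0// exprS; lra.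
rewrite mulrDr exprS -(mulrA 2 (2 ^+ k) s'); rewrite exprS in h2.
lra.
Qed.

(** The variance is at most the mean squared distance to the value at the empty configuration. The
    constant 3 bounds [2 * (1 + lam)]. *)
Lemma hcV_le_crude W g : lam <= 2^-1 ->
  hcV W g <= 3 * 2 ^+ #|W| * \sum_(v in W) hcD W v g.
Proof.
move=> l2; apply: le_trans (hcV_le_dist W g (g set0)) _.
rewrite /hcE ler_pdivrMr ?hcZ_gt0//; apply: le_trans (hcS_sqr_dist_le _ _ l2) _.
rewrite (mulrC 3) -!mulrA ler_wpM2l ?exprn_ge0// mulr_suml mulr_sumr.
apply: ler_sum => v vW; rewrite /hcD vW -/(diffS W v g).
have l1 : 1 + lam != 0 by rewrite gt_eqF// addr_gt0.
have -> : 3 * (lam / (1 + lam) * diffS W v g / hcZ W * hcZ W)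
  = (3 / (1 + lam)) * (lam * diffS W v g) by field; rewrite hcZ_neq0 l1.
rewrite -mulrA ler_wpM2r ?mulr_ge0 ?diffS_ge0// ler_pdivlMr ?addr_gt0//; lra.
Qed.

Lemma hcV_setU W W' g : [disjoint W & W'] ->
  (forall a b, a \in W -> b \in W' -> ~~ e a b) ->
  hcV (W :|: W') g = hcE W' (fun J' => hcV W (fun J => g (J :|: J')))
                     + hcV W' (fun J' => hcE W (fun J => g (J :|: J'))).
Proof.
move=> d n; rewrite /hcV !(hcE_setU _ d n).
rewrite (@eq_hcE W' (fun J' => hcE W (fun J => g (J :|: J') ^+ 2) - _)
  (fun J' => hcE W (fun J => g (J :|: J') ^+ 2)
             + -1 * hcE W (fun J => g (J :|: J')) ^+ 2)); last first.
  by move=> J _; rewrite mulN1r.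
by rewrite hcED hcEZ; ring.
Qed.

Lemma hcD_setUl W W' v g : v \in W -> [disjoint W & W'] ->
  (forall a b, a \in W -> b \in W' -> ~~ e a b) ->
  hcD (W :|: W') v g = hcE W' (fun J' => hcD W v (fun J => g (J :|: J'))).
Proof.
move=> vW d n; rewrite /hcD inE vW /= (hcZ_setU d n) (cut_setU vW d n).
have d' : [disjoint cut W v & W'] by apply: disjointWl d; exact: cut_sub.
have n' a b : a \in cut W v -> b \in W' -> ~~ e a b.
  by move/(subsetP (cut_sub _ _)); exact: n.
rewrite (hcS_setU _ d' n') /hcE.
have -> : hcS W' (fun J' => lam / (1 + lam) * hcS (cut W v)
     (fun J => (g (v |: J :|: J') - g (J :|: J')) ^+ 2) / hcZ W) =
   lam / (1 + lam) / hcZ W * hcS W' (fun J' => hcS (cut W v)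
     (fun J => (g (v |: (J :|: J')) - g (J :|: J')) ^+ 2)).
  rewrite -hcSZ; apply: eq_hcS => J' _; rewrite mulrAC; congr (_ * _).
  by apply: eq_hcS => J _; rewrite setUA.
by rewrite invfM; ring.
Qed.

(** By Jensen, averaging over the independent part [W] can only lower a local variance in [W']. *)
Lemma hcD_setUr W W' v g : v \in W' -> [disjoint W & W'] ->
  (forall a b, a \in W -> b \in W' -> ~~ e a b) ->
  hcD W' v (fun J' => hcE W (fun J => g (J :|: J'))) <= hcD (W :|: W') v g.
Proof.
move=> vW' d n; rewrite setUC; rewrite disjoint_sym in d.
have n' a b : a \in W' -> b \in W -> ~~ e a b by move=> aW bW; rewrite e_sym n.
have l1 : 0 <= lam / (1 + lam) by rewrite divr_ge0 ?addr_ge0.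
have c' a b : a \in W -> b \in cut W' v -> ~~ e a b.
  by move=> aW /(subsetP (cut_sub _ _)); exact: n.
have d' : [disjoint W & cut W' v].
  by rewrite disjoint_sym; apply: disjointWl d; exact: cut_sub.
rewrite /hcD vW' inE vW' /= (hcZ_setU d n') (cut_setU vW' d n') setUC.
rewrite (hcS_setU _ d' c') invfM; set B := (X in _ <= _ * X * _).
have -> : lam / (1 + lam) * B * ((hcZ W')^-1 * (hcZ W)^-1) =
  lam / (1 + lam) * ((hcZ W)^-1 * B) / hcZ W' by ring.
rewrite ler_pM2r ?invr_gt0 ?hcZ_gt0// ler_wpM2l// /B -hcSZ.
apply: le_hcS => J' _; rewrite mulrC -/(hcE _ _).
have -> : hcE W (fun J => g (J :|: (v |: J'))) - hcE W (fun J => g (J :|: J')) =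
    hcE W (fun J => g (v |: (J :|: J')) - g (J :|: J')).
  rewrite (@eq_hcE W (fun J => g (v |: (J :|: J')) - g (J :|: J'))
    (fun J => g (J :|: (v |: J')) + -1 * g (J :|: J'))) ?hcED ?hcEZ ?mulN1r//.
  by move=> J _; rewrite mulN1r setUCA.
exact: sqr_hcE_le.
Qed.

(** Tensorization: here the clusters are the connected components of [W]. Split off one component,
    apply the crude bound to it, and recurse on the rest. *)
Lemma hcV_le_clusters W g : lam <= 2^-1 ->
  hcV W g <= \sum_(v in W) 3 * 2 ^+ #|cluster e W [set v]| * hcD W v g.
Proof.
move=> l2; elim: {W}#|W| {-2}W (leqnn #|W|) g => [|k IHk] W cW g.
  move: cW; rewrite leqn0 cards_eq0 => /eqP ->.
  by apply: le_trans (hcV_le_crude _ _ l2) _; rewrite !big_set0 mulr0.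
have [W0|[x xW]] := set_0Vmem W.
  by apply: le_trans (hcV_le_crude _ _ l2) _; rewrite W0 !big_set0 mulr0.
set C := cluster e W [set x]; set W' := W :\: C.
have xC : x \in C by rewrite mem_cluster ?set11.
have CW : C \subset W := cluster_sub _ _ _.
have WE : W = C :|: W' by rewrite -{1}(setID W C) (setIidPr CW).
have d : [disjoint C & W'].
  rewrite -setI_eq0; apply/eqP/setP => y; rewrite in_setI in_setD in_set0.
  by case: (y \in C).
have n a b : a \in C -> b \in W' -> ~~ e a b.
  move=> aC; rewrite inE => /andP[bC bW]; apply: contra bC.
  exact: cluster_step.
have cW' : (#|W'| <= k)%N.
  rewrite -ltnS; apply: leq_trans cW; apply: proper_card; apply/properP.
  by split; [exact: subsetDl|exists x => //; rewrite in_setD xC].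
rewrite {1}WE (hcV_setU _ d n) (big_setID C) /= (setIidPr CW); apply: lerD.
  have -> : \sum_(v in C) 3 * 2 ^+ #|cluster e W [set v]| * hcD W v g =
     hcE W' (fun J' => \sum_(v in C) 3 * 2 ^+ #|cluster e W [set v]|
                          * hcD C v (fun J => g (J :|: J'))).
    rewrite hcE_sum; apply: eq_bigr => v vC.
    by rewrite hcEZ {2}WE (hcD_setUl _ vC d n).
  apply: le_hcE => J' _; apply: le_trans (hcV_le_crude _ _ l2) _.
  rewrite mulr_sumr; apply: ler_sum => v vC; rewrite ler_wpM2r ?hcD_ge0//.
  rewrite ler_wpM2l// ler_weXn2l ?ler1n// subset_leq_card//.
  exact: cluster_sym.
apply: le_trans (IHk _ cW' _) _; apply: ler_sum => v vW'.
apply: ler_pM; rewrite ?mulr_ge0 ?exprn_ge0 ?hcD_ge0//.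
  by rewrite ler_wpM2l// ler_weXn2l ?ler1n// subset_leq_card// clusterS// subsetDl.
by rewrite WE; exact: hcD_setUr.
Qed.

(** The weight of the local variance at [v] after [j] uniformly random vertices of [U] are revealed:
    a factor [rho] per vertex, then the component constant of what remains. The choice [u = v] is
    left out, as it leaves no local variance at [v]. The weights do not depend on the revealed
    values, and their mean over the random graph can be bounded term by term. *)
Fixpoint pinK (rho : R) (j : nat) U v : R :=
  if j is i.+1 then rho / #|U|%:R * \sum_(u in U :\ v) pinK rho i (U :\ u) v
  else 3 * 2 ^+ #|cluster e U [set v]|.

(* Revealing a uniformly random vertex of [U] loses a factor [1 - eta / #|U|]
   of the variance; this is iterated until [m] vertices remain. *)
Lemma hcV_le_pinK (m j : nat) (eta : R) U W g : lam <= 2^-1 -> 0 < eta -> eta < m%:R ->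
  (forall W' u, u \in W' -> 1 + infl (cut W' u) (W' :\ u) <= eta) ->
  #|U| = (m + j)%N -> W \subset U ->
  hcV W g <= \sum_(v in U) pinK (1 - eta / m%:R)^-1 j U v * hcD W v g.
Proof.
move=> l2 eta0 etam Heta; elim: j U W g => [|j IHj] U W g cU WU.
  apply: le_trans (hcV_le_clusters _ _ l2) _.
  rewrite [leLHS]big_mkcond [leRHS]big_mkcond; apply: ler_sum => v _ /=.
  have [vW|] := boolP (v \in W); last first.
    by case: ifP => // _ _; rewrite !mulr_ge0 ?exprn_ge0 ?hcD_ge0.
  rewrite (subsetP WU _ vW) ler_wpM2r ?hcD_ge0// ler_wpM2l// ler_weXn2l ?ler1n//.
  by rewrite subset_leq_card// clusterS.
have m0 : 0 < m%:R :> R by apply: lt_trans etam.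
set rho := (1 - eta / m%:R)^-1; set V := hcV W g.
have rho0 : 0 < 1 - eta / m%:R by rewrite subr_gt0 ltr_pdivrMr// mul1r.
have V0 : 0 <= V := hcV_ge0 _ _.
have km : m%:R <= #|U|%:R :> R by rewrite cU ler_nat leq_addr.
have k0 : 0 < #|U|%:R :> R by apply: lt_le_trans km.
(* The mean variance left after revealing [u]. A vertex of [U] outside [W] is already determined, so
   revealing it changes nothing. *)
pose A u := if u \in W then occ W u * hcV (cut W u) (pin u g)
                            + (1 - occ W u) * hcV (W :\ u) g else V.
have H1 : \sum_(u in U) (V - A u) <= eta * V.
  apply: le_trans (@spectral_independence W g eta eta0 (Heta W)).
  rewrite [leRHS]big_mkcond [leLHS]big_mkcond; apply: ler_sum => u _ /=.
  rewrite /A; have [uW|] := boolP (u \in W).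
    by rewrite (subsetP WU _ uW) /V (hcV_split _ uW) addrC addKr.
  by rewrite subrr if_same.
have H2 u : u \in U -> A u <= \sum_(v in U :\ u) pinK rho j (U :\ u) v * hcD W v g.
  move=> uU; rewrite /A.
  have cU' : #|U :\ u| = (m + j)%N.
    by move: cU; rewrite (cardsD1 u U) uU addnS => -[].
  have [uW|uW] := boolP (u \in W); last first.
    by apply: IHj => //; rewrite subsetD1 WU.
  have q0 := occ_ge0 W u; have q1 := occ_le1 uW.
  have -> : \sum_(v in U :\ u) pinK rho j (U :\ u) v * hcD W v g =
     occ W u * (\sum_(v in U :\ u) pinK rho j (U :\ u) v * hcD (cut W u) v (pin u g))
     + (1 - occ W u) * (\sum_(v in U :\ u) pinK rho j (U :\ u) v * hcD (W :\ u) v g).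
    rewrite !mulr_sumr -big_split /=; apply: eq_bigr => v; rewrite in_setD1 => /andP[vu _].
    by rewrite (hcD_split _ uW) 1?eq_sym//; ring.
  apply: lerD; rewrite ler_wpM2l// ?subr_ge0//; apply: IHj => //.
    by apply: subset_trans (cut_subD1 _ _) (setSD _ WU).
  exact: setSD.
(* The total loss is at most [eta * V], and [eta <= (eta / m) * #|U|] because at least [m] vertices
   remain. *)
have H3 : (1 - eta / m%:R) * #|U|%:R * V <= \sum_(u in U) A u.
  move: H1; rewrite big_split /= sumr_const sumrN.
  have : eta <= eta / m%:R * #|U|%:R.
    by rewrite mulrAC ler_pdivlMr// ler_wpM2l// ltW.
  move=> /(ler_wpM2r V0); rewrite -mulr_natr.
  move: (\sum_(u in U) A u) => s; lra.
have H4 : V <= rho / #|U|%:R * \sum_(u in U) A u.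
  rewrite /rho -invfM ler_pdivlMl//.
  by rewrite mulr_gt0.
apply: le_trans H4 _ => /=.
apply: (@le_trans _ _ (rho / #|U|%:R *
   \sum_(u in U) \sum_(v in U :\ u) pinK rho j (U :\ u) v * hcD W v g)).
  rewrite ler_wpM2l//; last exact: ler_sum.
  by rewrite divr_ge0 ?invr_ge0 ?(ltW rho0) ?(ltW k0).
rewrite (exchange_big_dep (fun v => v \in U)) /=; last first.
  by move=> u v _; rewrite inE => /andP[].
rewrite mulr_sumr; apply: ler_sum => v vU.
rewrite -mulr_suml mulrA le_eqVlt; apply/orP; left; apply/eqP.
congr (_ * _ * _); apply: eq_bigl => u.
by rewrite !inE vU andbT andbC eq_sym.
Qed.

(** ** Glauber dynamics *)

Definition upd v f (I : {set T}) : R :=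
  if [exists u in I, e u v] then f (I :\ v)
  else lam / (1 + lam) * f (v |: I) + 1 / (1 + lam) * f (I :\ v).

Definition glauber_op f (I : {set T}) : R := #|T|%:R^-1 * \sum_(v : T) upd v f I.

Let loc v f J : R := lam / (1 + lam) * f (v |: J) + 1 / (1 + lam) * f J.

Let blocked v J := (J \subset setT :\ v) && ~~ (J \subset cut setT v).

(** Sorts configurations by the fibres of the update at [v]: a blocked one is alone in its fibre,
    the others come in pairs [J], [v |: J] with weights in ratio [1 : lam]. *)
Lemma hcS_site v h : hcS setT h = \sum_(J | blocked v J) hcw J * h J
  + hcS (cut setT v) (fun J => h J + lam * h (v |: J)).
Proof.
rewrite (hcS_split _ (in_setT v)) hcSD hcSZ addrA; congr (_ + _).
rewrite /hcS (bigID (fun J : {set T} => J \subset cut setT v)) /= addrC; congr (_ + _).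
apply: eq_bigl => J; case: (boolP (J \subset cut setT v)); rewrite ?andbF// andbT => s.
exact: subset_trans s (cut_subD1 _ _).
Qed.

Lemma upd_blocked v f J : blocked v J -> upd v f J = f J.
Proof.
move=> /andP[+ /subsetPn[u uJ]]; rewrite subsetD1 => /andP[_ vJ].
rewrite in_cut in_setT andbT negb_and !negbK => uv.
have {}uv : e u v.
  by case/orP: uv => [|/eqP uv]; [rewrite e_sym|rewrite -uv uJ in vJ].
rewrite /upd ifT; last by apply/exists_inP; exists u.
by congr f; apply/setP => x; rewrite !inE; case: eqP => // ->; rewrite (negbTE vJ).
Qed.

Lemma upd_free v f J : J \subset cut setT v ->
  upd v f J = loc v f J /\ upd v f (v |: J) = loc v f J.
Proof.
move=> s; have vJ : v \notin J by apply/negP => /(subsetP s); rewrite in_cut eqxx andbF.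
have n u : u \in J -> e u v = false.
  by move/(subsetP s); rewrite in_cut e_sym => /andP[/negbTE].
have JE : J :\ v = J.
  by apply/setP => x; rewrite !inE; case: eqP => // ->; rewrite (negbTE vJ).
split.
  by rewrite /upd ifF ?JE//; apply/negbTE/negP => /exists_inP[u uJ]; rewrite n.
rewrite /upd ifF; first by rewrite setU1K// setUA setUid.
apply/negbTE/negP => /exists_inP[u]; rewrite in_setU1.
by case/orP => [/eqP ->|uJ]; rewrite ?e_irr ?n.
Qed.

Let lam1 : 1 + lam != 0. Proof. by rewrite gt_eqF// addr_gt0. Qed.

Lemma hcS_mul_upd v f g : hcS setT (fun J => f J * upd v g J) =
  \sum_(J | blocked v J) hcw J * (f J * g J)
  + (1 + lam) * hcS (cut setT v) (fun J => loc v f J * loc v g J).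
Proof.
rewrite (hcS_site v); congr (_ + _).
  by apply: eq_bigr => J /upd_blocked ->.
rewrite -hcSZ; apply: eq_hcS => J /(upd_free g)[-> ->]; rewrite /loc; field.
exact: lam1.
Qed.

Lemma hcS_upd_sym v f g :
  hcS setT (fun J => f J * upd v g J) = hcS setT (fun J => upd v f J * g J).
Proof.
rewrite hcS_mul_upd (@eq_hcS setT _ (fun J => g J * upd v f J)) ?hcS_mul_upd.
  congr (_ + _ * _); first by apply: eq_bigr => J _; rewrite (mulrC (f J)).
  by apply: eq_hcS => J _; rewrite mulrC.
by move=> J _; rewrite mulrC.
Qed.

(** The update at [v] is a conditional expectation, so it removes exactly the expected conditional
    variance from the second moment. *)
Lemma hcE_sqr_upd v f :
  hcE setT (fun J => upd v f J ^+ 2) = hcE setT (fun J => f J ^+ 2) - hcD setT v f.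
Proof.
rewrite /hcE /hcD in_setT -mulrBl; congr (_ / _); rewrite !(hcS_site v).
rewrite -addrA; congr (_ + _).
  by apply: eq_bigr => J /upd_blocked ->.
apply/eqP; rewrite eq_sym subr_eq eq_sym -hcSZ -hcSD; apply/eqP; apply: eq_hcS => J.
move=> /(upd_free f)[-> ->]; rewrite /loc; field.
exact: lam1.
Qed.

Lemma hcS_glauber_op_sym f g :
  hcS setT (fun J => f J * glauber_op g J) = hcS setT (fun J => glauber_op f J * g J).
Proof.
rewrite (@eq_hcS setT _ (fun J => #|T|%:R^-1 * \sum_v f J * upd v g J)); last first.
  by move=> J _; rewrite /glauber_op mulrCA mulr_sumr.
rewrite [RHS](@eq_hcS setT _ (fun J => #|T|%:R^-1 * \sum_v upd v f J * g J)); last first.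
  by move=> J _; rewrite /glauber_op -mulrA mulr_suml.
by rewrite !hcSZ !hcS_sum; congr (_ * _); apply: eq_bigr => v _; exact: hcS_upd_sym.
Qed.

(** Reversibility: when a law has density [f] relative to the hard-core measure, one step of the
    chain turns this density into [glauber_op f]. *)
Lemma glauber_op_adjoint f J :
  \sum_(I : {set T}) hcw I * f I * glauber_op (fun I' => (J == I')%:R) I
  = hcw J * glauber_op f J.
Proof.
transitivity (hcS setT (fun I => f I * glauber_op (fun I' => (J == I')%:R) I)).
  by rewrite /hcS; apply: eq_big => I; [rewrite subsetT|rewrite mulrA].
rewrite hcS_glauber_op_sym /hcS (bigD1 J) ?subsetT//= eqxx mulr1 big1 ?addr0//.
by move=> I /andP[_ /negbTE]; rewrite eq_sym => ->; rewrite !mulr0.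
Qed.

Lemma upd_cst v c I : upd v (fun=> c) I = c.
Proof. by rewrite /upd; case: ifP => // _; field; exact: lam1. Qed.

Hypothesis T_gt0 : (0 < #|T|)%N.

Let n_gt0 : 0 < #|T|%:R :> R. Proof. by rewrite ltr0n. Qed.

Lemma hcE_glauber_op f : hcE setT (glauber_op f) = hcE setT f.
Proof.
have cE J : glauber_op (fun=> 1) J = 1.
  rewrite /glauber_op (eq_bigr (fun=> 1)) ?sumr_const ?mulVf ?gt_eqF// => v _.
  by rewrite upd_cst.
have := hcS_glauber_op_sym (fun=> 1) f; rewrite /hcE.
rewrite (@eq_hcS setT (fun J => 1 * _) (glauber_op f)); last by move=> J _; rewrite mul1r.
by move=> ->; congr (_ / _); apply: eq_hcS => J _; rewrite cE mul1r.
Qed.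

Lemma sqr_mean_le (F : T -> R) :
  (#|T|%:R^-1 * \sum_v F v) ^+ 2 <= #|T|%:R^-1 * \sum_v F v ^+ 2.
Proof.
set m := _ * _.
have : 0 <= #|T|%:R^-1 * \sum_v (F v - m) ^+ 2.
  by rewrite mulr_ge0 ?invr_ge0// sumr_ge0// => v _; exact: sqr_ge0.
rewrite (eq_bigr (fun v => F v ^+ 2 + (- 2 * m * F v + m ^+ 2))); last by move=> v _; ring.
rewrite !big_split /= -mulr_sumr.
have -> : \sum_(v : T) m ^+ 2 = #|T|%:R * m ^+ 2 by rewrite sumr_const mulr_natl.
have sE : \sum_v F v = #|T|%:R * m by rewrite /m mulrA mulfV ?mul1r// gt_eqF.
rewrite sE; set s := \sum_v _.
have -> : #|T|%:R^-1 * (s + (- 2 * m * (#|T|%:R * m) + #|T|%:R * m ^+ 2))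
  = #|T|%:R^-1 * s - m ^+ 2 by field; rewrite gt_eqF.
by rewrite subr_ge0.
Qed.

(** The mean is preserved, and convexity bounds the square of the average over sites by the average
    of the squares. *)
Lemma hcV_glauber_op f :
  hcV setT (glauber_op f) <= hcV setT f - #|T|%:R^-1 * \sum_v hcD setT v f.
Proof.
rewrite /hcV hcE_glauber_op addrAC lerD2r.
apply: (@le_trans _ _ (hcE setT (fun J => #|T|%:R^-1 * \sum_v upd v f J ^+ 2))).
  by apply: le_hcE => J _; exact: sqr_mean_le.
rewrite hcEZ hcE_sum; under eq_bigr do rewrite hcE_sqr_upd.
rewrite sumrB mulrBr sumr_const -(mulr_natl (hcE _ _)) mulrA mulVf ?mul1r//.
by rewrite gt_eqF.
Qed.

Lemma hcV_iter_glauber_op (K : R) t f : 1 <= #|T|%:R * K ->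
  (forall g, hcV setT g <= K * \sum_v hcD setT v g) ->
  hcV setT (iter t glauber_op f) <= (1 - (#|T|%:R * K)^-1) ^+ t * hcV setT f.
Proof.
move=> K1 HK; have K0 : 0 < K by rewrite -(pmulr_rgt0 _ n_gt0); apply: lt_le_trans K1.
have c0 : 0 <= 1 - (#|T|%:R * K)^-1 by rewrite subr_ge0 invf_le1 ?(lt_le_trans ltr01).
elim: t => [|t IHt]; first by rewrite expr0 mul1r.
rewrite iterS exprS -mulrA; set g := iter t _ f in IHt *.
apply: le_trans (hcV_glauber_op g) _.
apply: (@le_trans _ _ ((1 - (#|T|%:R * K)^-1) * hcV setT g)); last by rewrite ler_wpM2l.
rewrite mulrBl mul1r lerD2l lerN2 invfM -mulrA ler_wpM2l ?invr_ge0 ?(ltW n_gt0)//.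
by rewrite ler_pdivrMl.
Qed.

Lemma hcZ_le W : hcZ W <= (1 + lam) ^+ #|W|.
Proof.
elim: {W}#|W| {-2}W (erefl #|W|) => [|k IHk] W cW.
  move/eqP: cW; rewrite cards_eq0 => /eqP ->.
  by rewrite /hcZ hcS_set0 cards0 expr0.
have [x xW] : exists x, x \in W by apply/set0Pn; rewrite -card_gt0 cW.
have cW' : #|W :\ x| = k by move: cW; rewrite (cardsD1 x W) xW => -[].
have IH := IHk _ cW'; rewrite cW' in IH.
rewrite cW (hcZ_split xW) exprS mulrDl mul1r lerD// ler_wpM2l//.
by apply: le_trans IH; apply: hcS_mono => //; exact: cut_subD1.
Qed.

(** The initial function is the density of the point mass at [I0]. Its variance decays
    geometrically; once it is at most [1/4], Cauchy-Schwarz bounds the mean of [|h - 1|] by [1/2],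
    that is, total variation by [1/4]. *)
Lemma glauber_tv_le (K : R) t I0 : lam <= 1 -> indep I0 -> 1 <= #|T|%:R * K ->
  (forall g, hcV setT g <= K * \sum_v hcD setT v g) ->
  (1 - (#|T|%:R * K)^-1) ^+ t * ((1 + lam) / lam) ^+ #|T| <= 4^-1 ->
  2^-1 * \sum_(J : {set T}) `|hcw J / hcZ setT *
     iter t glauber_op (fun I => (I0 == I)%:R * (hcZ setT / hcw I0)) J - hcw J / hcZ setT|
  <= 4^-1.
Proof.
move=> lam_le1 iI0 K1 HK tK; pose h0 (I : {set T}) : R := (I0 == I)%:R * (hcZ setT / hcw I0).
rewrite -/h0; set h := iter t glauber_op h0.
have w0 : 0 < hcw I0 by rewrite /hcw iI0 exprn_gt0.
have Z0 := hcZ_gt0 setT.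
have E0 F : hcE setT (fun I => (I0 == I)%:R * F I) = hcw I0 / hcZ setT * F I0.
  rewrite /hcE /hcS (bigD1 I0) ?subsetT//= eqxx mul1r big1 ?addr0 1?mulrAC//.
  by move=> I /andP[_ /negbTE]; rewrite eq_sym => ->; rewrite mul0r mulr0.
have Eh0 : hcE setT h0 = 1 by rewrite E0; field; rewrite !gt_eqF.
have Eh : hcE setT h = 1.
  by rewrite /h; elim: (t) => //= s <-; rewrite hcE_glauber_op.
(* The initial variance is below the inverse probability of [I0]; the partition function is at most
   [(1 + lam) ^ n], and [lam <= 1] makes every independent set weigh at least [lam ^ n], with [n]
   the number of vertices. *)
have Vh0 : hcV setT h0 <= ((1 + lam) / lam) ^+ #|T|.
  apply: (@le_trans _ _ (hcZ setT / hcw I0)).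
    rewrite /hcV Eh0 expr1n.
    rewrite (@eq_hcE setT _ (fun I => (I0 == I)%:R * (hcZ setT / hcw I0) ^+ 2)).
      rewrite E0 expr2 mulrA (_ : hcw I0 / hcZ setT * (hcZ setT / hcw I0) = 1) ?mul1r.
        by rewrite gerBl.
      by field; rewrite !gt_eqF.
    by move=> I _; rewrite /h0; case: (I0 == I); rewrite ?mul1r ?mul0r ?expr0n.
  rewrite expr_div_n ler_pM ?invr_ge0 ?(ltW Z0) ?(ltW w0)//.
    by apply: le_trans (hcZ_le _) _; rewrite cardsT.
  rewrite lef_pV2 ?posrE ?exprn_gt0// /hcw iI0.
  by rewrite ler_wiXn2l// max_card.
have Vh : hcV setT h <= 4^-1.
  apply: le_trans (hcV_iter_glauber_op _ _ K1 HK) _; apply: le_trans tK.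
  rewrite ler_wpM2l// exprn_ge0// subr_ge0 invf_le1 ?(lt_le_trans ltr01)//.
have -> : \sum_(J : {set T}) `|hcw J / hcZ setT * h J - hcw J / hcZ setT|
   = hcE setT (fun J => `|h J - 1|).
  rewrite /hcE /hcS mulr_suml; apply: eq_big => J; first by rewrite subsetT.
  move=> _; rewrite -[X in _ - X]mulr1 -mulrBr normrM ger0_norm 1?mulrAC//.
  by rewrite divr_ge0 ?hcw_ge0 ?(ltW Z0).
set a := hcE _ _.
have a0 : 0 <= a by apply: hcE_ge0.
have : a ^+ 2 <= 4^-1.
  apply: le_trans (sqr_hcE_le _ _) _; apply: le_trans Vh.
  rewrite hcVE Eh le_eqVlt; apply/orP; left; apply/eqP; apply: eq_hcE => J _.
  by rewrite real_normK ?num_real.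
move=> a2; nra.
Qed.

End HardCoreMeasure.

(** * Random graphs *)

Section RandomGraph.
Variables (R : realType) (n : nat).
Implicit Types (E : {set {set 'I_n}}) (O W X U : {set 'I_n}) (p r t M : R).

Lemma adj_sym E : symmetric (adj E).
Proof. by move=> u v; rewrite /adj setUC. Qed.

Lemma adj_irr E : E \subset pairs n -> irreflexive (adj E).
Proof.
move=> EP u; apply/negbTE/negP => /(subsetP EP).
by rewrite !inE setUid cards1.
Qed.

Lemma cluster_adj_avoid E1 E2 O X x : x \notin O ->
  (forall d, d \in E1 -> x \in d) ->
  cluster (adj (E1 :|: E2)) O X = cluster (adj E2) O X.
Proof.
move=> xO xE1; apply/setP => w; rewrite !inE; apply: eq_existsb => y; congr (_ && _).
apply: eq_connect => a b; rewrite /inrel.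
have [aO|] := boolP (a \in O) => //=; have [bO|] := boolP (b \in O) => //=.
rewrite /adj inE; case: (boolP (_ \in E1)) => // /xE1.
by rewrite !inE => /orP[/eqP ab|/eqP ab]; rewrite ab ?aO ?bO in xO.
Qed.

(* Exploring the cluster of [X] vertex by vertex: an open vertex [x] of [X]
   costs a factor [t] and adds to [X] its at most [k] potential neighbours,
   each with probability [r]. *)
Lemma bern_cluster_le k W X p r t M : 0 <= p <= 1 -> 0 <= r <= 1 -> 1 <= t -> 1 <= M ->
  p * t * (1 + r * (M - 1)) ^+ k + (1 - p) <= M -> (#|W| <= k)%N ->
  bern (pairs n) r (fun E => bern W p (fun O => t ^+ #|cluster (adj E) O X|))
  <= M ^+ #|X :&: W|.
Proof.
move=> p01 r01 t1 M1 HM; have [p0 p1] := andP p01; have [r0 _] := andP r01.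
have t0 : 0 <= t by apply: le_trans t1.
have M0 : 0 <= M by apply: le_trans M1.
have b0 : 1 <= 1 + r * (M - 1) by rewrite lerDl mulr_ge0// subr_ge0.
elim: {W}#|W| {-2}W (erefl #|W|) X => [|k0 IHk] W cW X Wk.
  rewrite (@eq_bern _ _ _ _ _ (fun=> 1)) ?bern_cst ?exprn_ege1// => E _.
  move/eqP: cW; rewrite cards_eq0 => /eqP ->; rewrite bern_set0 cluster0 ?cards0//.
  by rewrite disjoint_sym; apply/pred0P => y; rewrite !inE.
have [d|] := boolP [disjoint X & W].
  rewrite (@eq_bern _ _ _ _ _ (fun=> 1)) ?bern_cst ?exprn_ege1// => E _.
  rewrite (@eq_bern _ _ _ _ _ (fun=> 1)) ?bern_cst// => O OW.
  by rewrite cluster0 ?cards0//; apply: disjointWr d.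
rewrite -setI_eq0 => /set0Pn[x]; rewrite inE => /andP[xX xW].
have cW' : #|W :\ x| = k0 by move: cW; rewrite (cardsD1 x W) xW => -[].
have Wk' : (#|W :\ x| <= k)%N by rewrite cW'; apply: leq_trans Wk; rewrite cW.
have xXW : x \in X :&: W by rewrite inE xX.
have cX : #|X :&: W| = #|X :&: (W :\ x)|.+1.
  by rewrite (cardsD1 x (X :&: W)) xXW setIDA.
rewrite (@eq_bern _ _ _ _ _ (fun E =>
   p * bern (W :\ x) p (fun O => t ^+ #|cluster (adj E) (x |: O) X|) +
   (1 - p) * bern (W :\ x) p (fun O => t ^+ #|cluster (adj E) O X|))); last first.
  by move=> E _; rewrite (bern_setD1 _ _ xW).
rewrite bernD !bernZ cX exprSr.
set m := #|X :&: (W :\ x)|.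
have H2 : bern (pairs n) r (fun E =>
    bern (W :\ x) p (fun O => t ^+ #|cluster (adj E) O X|)) <= M ^+ m.
  exact: IHk.
suff H1 : bern (pairs n) r (fun E =>
    bern (W :\ x) p (fun O => t ^+ #|cluster (adj E) (x |: O) X|))
    <= t * (M ^+ m * (1 + r * (M - 1)) ^+ k).
  apply: (@le_trans _ _ (M ^+ m * (p * t * (1 + r * (M - 1)) ^+ k + (1 - p)))).
    have h1 := ler_wpM2l p0 H1.
    have h2 : (1 - p) * _ <= _ := ler_wpM2l (_ : 0 <= 1 - p) H2.
    rewrite subr_ge0 in h2; have {}h2 := h2 p1.
    apply: le_trans (lerD h1 h2) _; rewrite le_eqVlt; apply/orP; left; apply/eqP; ring.
  by rewrite ler_wpM2l// exprn_ge0.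
apply: (@le_trans _ _ (bern (pairs n) r (fun E => t *
    bern (W :\ x) p (fun O => t ^+ #|cluster (adj E) O (X :|: nbhd (adj E) x)|)))).
  apply: le_bern => // E _; rewrite -bernZ; apply: le_bern => // O _.
  rewrite -exprS ler_weXn2l//.
  apply: leq_trans (subset_leq_card (cluster_explore_sub _ _ _ _)) _.
  by rewrite cardsU1 -add1n leq_add2r leq_b1.
rewrite bernZ ler_wpM2l//.
(* The edges at [x] determine its neighbours, the remaining edges determine the clusters avoiding
   [x]; the two families are independent. *)
pose A := [set d in pairs n | x \in d]; pose B := pairs n :\: A.
have dAB : [disjoint A & B].
  rewrite -setI_eq0; apply/eqP/setP => y; rewrite in_setI in_setD in_set0.
  by case: (y \in A).
have PE : pairs n = A :|: B.
  rewrite -{1}(setID (pairs n) A); congr (_ :|: _); apply/setIidPr.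
  by apply/subsetP => y; rewrite inE => /andP[].
pose Q := [set [set x; y] | y in W :\ x].
have E1x E1 d : E1 \subset A -> d \in E1 -> x \in d.
  by move=> /subsetP s /s; rewrite inE => /andP[].
have cAQ : (#|A :&: Q| <= k)%N.
  apply: leq_trans (subset_leq_card (subsetIr _ _)) _.
  exact: leq_trans (leq_imset_card _ _) Wk'.
apply: (@le_trans _ _ (bern A r (fun E1 => M ^+ m * M ^+ #|E1 :&: Q|))); last first.
  by rewrite bernZ bern_expr_cardI ler_wpM2l ?exprn_ge0// ler_weXn2l.
rewrite PE (bern_setU _ _ dAB); apply: le_bern => // E1 E1A.
pose Y := X :|: nbhd (adj E1) x.
rewrite (@eq_bern _ _ _ _ _ (fun E2 =>
   bern (W :\ x) p (fun O => t ^+ #|cluster (adj E2) O Y|))); last first.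
  move=> E2 E2B; apply: eq_bern => O; rewrite subsetD1 => /andP[_ xO].
  rewrite (cluster_adj_avoid _ _ xO); last by move=> d; exact: E1x.
  congr (_ ^+ #|cluster _ _ (_ :|: _)|); apply/setP => y; rewrite !inE /adj inE.
  case: (boolP (_ \in E2)); rewrite ?orbF// => /(subsetP E2B).
  rewrite in_setD => /andP[/negP nA dP]; case: nA.
  by rewrite inE dP set21.
(* Clusters avoiding [x] do not see the edges at [x], so these may be resampled; this restores the
   full random graph of the induction hypothesis. *)
have -> : bern B r (fun E2 => bern (W :\ x) p (fun O => t ^+ #|cluster (adj E2) O Y|))
   = bern (pairs n) r (fun E => bern (W :\ x) p (fun O => t ^+ #|cluster (adj E) O Y|)).
  rewrite [in RHS]PE (bern_setU _ _ dAB) -[LHS](bern_cst A r).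
  apply: eq_bern => E1' E1A'; apply: eq_bern => E2 _; apply: eq_bern => O.
  rewrite subsetD1 => /andP[_ xO].
  by rewrite (cluster_adj_avoid _ _ xO)// => d; exact: E1x.
apply: le_trans (IHk _ cW' Y Wk') _; rewrite -exprD ler_weXn2l//.
rewrite /Y setIUl; apply: leq_trans (leq_card_setU _ _) _; rewrite leq_add2l.
rewrite -(card_in_imset (f := fun y => [set x; y])).
  apply: subset_leq_card; apply/subsetP => d /imsetP[y]; rewrite !inE => /and3P[xy yx yW] ->.
  by rewrite -/(adj E1 x y) xy; apply/imsetP; exists y; rewrite ?inE ?yx.
move=> y z; rewrite !inE => /and3P[_ yx _] _ /setP /(_ y); rewrite !inE eqxx orbT.
by rewrite (negbTE yx) => /esym /eqP.
Qed.

(** At [j = 0], the exploration bound with every vertex open, [t = 2] and [M = 4] applies, since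
    [2 * (1 + 3 r) ^ m <= 4]; hence [12 = 3 * 4]. Each averaging step then costs at most [rho]. *)
Lemma bern_pinK_le m j U v r rho : 0 <= r <= 1 -> 0 <= rho ->
  (1 + r * 3) ^+ m <= 2 -> #|U| = (m + j)%N ->
  bern (pairs n) r (fun E => pinK (adj E) rho j U v) <= 12 * rho ^+ j.
Proof.
move=> r01 rho0 Hm; elim: j U => [|j IHj] U cU /=.
  rewrite bernZ expr0 mulr1 (_ : 12 = 3 * 4); last by ring.
  rewrite ler_wpM2l//.
  rewrite (@eq_bern _ _ _ _ _ (fun E =>
    bern U 1 (fun O => 2 ^+ #|cluster (adj E) O [set v]|))); last first.
    by move=> E _; rewrite bern_p1.
  apply: le_trans (@bern_cluster_le m U _ 1 r 2 4 _ _ _ _ _ _) _;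
    rewrite ?ler01 ?lexx ?ler1n ?cU ?addn0//.
    rewrite mul1r subrr addr0 (_ : 4 - 1 = 3); last by ring.
    by rewrite (_ : 4 = 2 * 2) ?ler_wpM2l//; ring.
  rewrite -[leRHS]expr1 ler_weXn2l ?ler1n// -(cards1 v) subset_leq_card//.
  exact: subsetIl.
rewrite bernZ bern_sum.
apply: (@le_trans _ _ (rho / #|U|%:R * \sum_(u in U :\ v) 12 * rho ^+ j)).
  rewrite ler_wpM2l ?divr_ge0//; apply: ler_sum => u; rewrite inE => /andP[_ uU].
  by apply: IHj; move: cU; rewrite (cardsD1 u U) uU addnS => -[].
rewrite sumr_const -(mulr_natl (12 * _)).
have k0 : 0 < #|U|%:R :> R by rewrite ltr0n cU addnS.
have le : #|U :\ v|%:R <= #|U|%:R :> R by rewrite ler_nat subset_leq_card ?subsetDl.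
have -> : rho / #|U|%:R * (#|U :\ v|%:R * (12 * rho ^+ j)) =
  12 * (rho * rho ^+ j) * (#|U :\ v|%:R / #|U|%:R) by ring.
rewrite exprS -[leRHS]mulr1 ler_wpM2l ?mulr_ge0 ?exprn_ge0//.
by rewrite ler_pdivrMr// mul1r.
Qed.

Lemma gnp_probE r (a : pred {set {set 'I_n}}) :
  gnp_prob r a = bern (pairs n) r (fun E => (a E)%:R).
Proof.
rewrite /gnp_prob /bern [LHS]big_mkcond [RHS]big_mkcond; apply: eq_bigr => E _.
by rewrite /gnp_weight; case: (a E); case: ifP => //; rewrite ?mulr1 ?mulr0.
Qed.

End RandomGraph.

(** * From cluster bounds to mixing on a fixed graph *)

Section GraphMixing.
Variables (R : realType) (n : nat) (E : {set {set 'I_n}}) (lam : R).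
Hypotheses (E_pairs : E \subset pairs n) (lam_gt0 : 0 < lam) (lam_le : lam <= 2^-1).
Local Notation p := (lam / (1 + lam)).

(** Occupying [u] instead of emptying it changes the free vertices only inside the neighbourhood of
    [u]. Hence one percolation bound on the whole graph controls the influence of [u] in all induced
    subgraphs. *)
Lemma poincare_of_clusters (m : nat) (eta K : R) : (m <= n)%N -> 0 < eta -> eta < m%:R ->
  (forall u, 1 + bern (setT :\ u) p (fun O =>
      #|cluster (adj E) O (nbhd (adj E) u)|%:R) <= eta) ->
  (forall v, pinK (adj E) (1 - eta / m%:R)^-1 (n - m) setT v <= K) ->
  forall g, hcV (adj E) lam setT g <= K * \sum_v hcD (adj E) lam setT v g.
Proof.
move=> mn eta0 etam Heta HK g; have es := @adj_sym n E; have ei := adj_irr E_pairs.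
have cT : #|[set: 'I_n]| = (m + (n - m))%N by rewrite cardsT card_ord subnKC.
apply: le_trans (hcV_le_pinK es ei lam_gt0 g lam_le eta0 etam _ cT (subxx _)) _.
  move=> W u uW; apply: le_trans (Heta u); rewrite lerD2l.
  apply: infl_le_cluster => //.
  - by apply: subset_trans (cut_subD1 _ _ _) (setSD _ (subsetT _)).
  - exact: setSD (subsetT _).
  - apply/subsetP => y; rewrite in_setD => /andP[yW].
    by move/(subsetP (cut_subD1 _ _ _)) => yW'; rewrite yW' in yW.
  - apply/subsetP => y; rewrite in_setD in_cut in_setD1 => /andP[+ /andP[yu yW]].
    by rewrite yu yW !andbT negbK inE.
rewrite mulr_sumr [leRHS](eq_bigl (fun v => v \in setT)); last by move=> v; rewrite inE.
by apply: ler_sum => v _; rewrite ler_wpM2r ?hcD_ge0.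
Qed.

Lemma glauber_distE t I0 J : is_indep E I0 ->
  glauber_dist E lam t I0 J = hcw (adj E) lam J / hcZ (adj E) lam setT *
    iter t (glauber_op (adj E) lam)
      (fun I => (I0 == I)%:R * (hcZ (adj E) lam setT / hcw (adj E) lam I0)) J.
Proof.
move=> iI0; have Z0 := hcZ_gt0 (adj E) lam_gt0 setT.
have iI : indep (adj E) I0 := iI0.
have w0 : 0 < hcw (adj E) lam I0 by rewrite /hcw iI exprn_gt0.
rewrite /glauber_dist; elim: t J => [|t IHt] J.
  rewrite /= eq_sym; case: eqP => [<-|_]; last by rewrite mul0r mulr0.
  by rewrite mul1r mulrA divfK ?gt_eqF// divff ?gt_eqF.
rewrite !iterS /glauber_step mulrAC.
rewrite -(glauber_op_adjoint (@adj_sym n E) (adj_irr E_pairs) lam_gt0) mulr_suml.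
apply: eq_bigr => I _; rewrite IHt.
have -> : glauber_P E lam I J = glauber_op (adj E) lam (fun I' => (J == I')%:R) I.
  by rewrite /glauber_P /glauber_op card_ord.
by ring.
Qed.

Lemma tv_dist_glauber_le (K : R) t I0 : (0 < n)%N -> is_indep E I0 -> 1 <= n%:R * K ->
  (forall g, hcV (adj E) lam setT g <= K * \sum_v hcD (adj E) lam setT v g) ->
  (1 - (n%:R * K)^-1) ^+ t * ((1 + lam) / lam) ^+ n <= 4^-1 ->
  tv_dist (glauber_dist E lam t I0) (hc_mu E lam) <= 4^-1.
Proof.
move=> n0 iI0 nK HK tK; rewrite /tv_dist.
have muE J : hc_mu E lam J = hcw (adj E) lam J / hcZ (adj E) lam setT.
  rewrite /hc_mu; congr (_ / _); rewrite /hcZ /hcS.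
  by apply: eq_big => I; rewrite ?subsetT// mulr1.
under eq_bigr do rewrite muE glauber_distE//.
apply: (@glauber_tv_le _ _ (adj E) lam (@adj_sym n E) (adj_irr E_pairs) lam_gt0 _ K);
  rewrite ?card_ord//.
by apply: le_trans lam_le _; rewrite invf_le1 ?ler1n.
Qed.

End GraphMixing.

(** * Jensen's inequality and estimates for exponential and logarithm *)

Section Asymptotics.
Variable R : realType.
Implicit Types (x y c : R).

(** Jensen, from the tangent line of the exponential at the mean [a]. *)
Lemma expR_bern_le (T : finType) (P : {set T}) (p : R) (g : {set T} -> R) : 0 <= p <= 1 ->
  expR (bern P p g) <= bern P p (fun O => expR (g O)).
Proof.
move=> p01; set a := bern P p g.
apply: (@le_trans _ _ (bern P p (fun O => expR a * (1 - a + g O)))).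
  by rewrite bernZ bernD bern_cst -/a subrK mulr1.
apply: le_bern => // O _.
have -> : expR (g O) = expR a * expR (g O - a) by rewrite -expRD addrC subrK.
by rewrite ler_wpM2l ?expR_ge0// -addrA [- a + _]addrC expR_ge1Dx.
Qed.

(** With probability [p] the vertex [u] is open, and its cluster then contains [u] and the cluster
    of its neighbours in the rest. Jensen turns the exponential moment into a bound on the mean. *)
Lemma mean_cluster_le (T : finType) (e : rel T) u (p theta eta : R) : 0 < p <= 1 -> 0 < theta ->
  bern setT p (fun O => expR theta ^+ #|cluster e O [set u]|) <= p * expR (theta * eta) ->
  1 + bern (setT :\ u) p (fun O => #|cluster e O (nbhd e u)|%:R) <= eta.
Proof.
move=> /andP[p0 p1] th0 H; have p01 : 0 <= p <= 1 by rewrite (ltW p0).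
have t1 : 1 <= expR theta by rewrite -expR0 ler_expR ltW.
rewrite -(ler_pM2l th0) -ler_expR -(ler_pM2l p0); apply: le_trans H.
rewrite (bern_setD1 _ _ (in_setT u)) -[leLHS]addr0; apply: lerD; last first.
  rewrite mulr_ge0 ?subr_ge0// bern_ge0// => O _; exact/exprn_ge0/expR_ge0.
rewrite ler_wpM2l ?(ltW p0)// -{1}(bern_cst (setT :\ u) p 1) -bernD -bernZ.
apply: le_trans (expR_bern_le _ _ p01) _; apply: le_bern => // O; rewrite subsetD1 => /andP[_ uO].
rewrite (addrC 1) natr1 expRM_natr ler_weXn2l//.
apply: leq_trans (subset_leq_card (cluster_explore_sup e O (set11 u))).
rewrite cardsU1.
have -> : u \notin cluster e O ([set u] :|: nbhd e u).
  by apply/negP => /(subsetP (cluster_sub _ _ _)); rewrite (negbTE uO).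
by rewrite add1n ltnS subset_leq_card// clusterS// subsetUr.
Qed.

Lemma ler_1DX_expR x k : 0 <= 1 + x -> (1 + x) ^+ k <= expR (x * k%:R).
Proof. by move=> x0; rewrite expRM_natr lerXn2r ?nnegrE ?expR_ge0 ?expR_ge1Dx. Qed.

Lemma expR_le_inv1B x : x < 1 -> expR x <= (1 - x)^-1.
Proof.
move=> x1; rewrite -[x in expR x]opprK expRN lef_pV2 ?posrE ?expR_gt0 ?subr_gt0//.
exact: expR_ge1Dx.
Qed.

Lemma inv1B_le_expR x : 0 <= x <= 2^-1 -> (1 - x)^-1 <= expR (2 * x).
Proof.
move=> /andP[x0 x1]; have xp : 0 < 1 - x by lra.
rewrite -[leLHS]mul1r ler_pdivrMr//.
apply: (@le_trans _ _ ((1 + 2 * x) * (1 - x))); first by nra.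
by rewrite ler_wpM2r ?(ltW xp) ?expR_ge1Dx.
Qed.

Lemma ln_le_of_sqr_le c x : 0 <= c -> 1 <= x -> (2 * c) ^+ 2 <= x -> c * ln x <= x.
Proof.
move=> c0 x1 cx; have x0 : 0 < x by apply: lt_le_trans x1.
set s := Num.sqrt x; have s0 : 0 < s by rewrite sqrtr_gt0.
have sx : s ^+ 2 = x by rewrite sqr_sqrtr ?(ltW x0).
have cs : 2 * c <= s.
  by rewrite -(@ler_pXn2r _ 2)// ?nnegrE ?mulr_ge0 ?(ltW s0)// sx.
have ls : ln s <= s by apply: le_trans (ltW (ln_sublinear s0)) _.
rewrite -sx lnXn// mulr2n; nra.
Qed.

End Asymptotics.

(** * Typical random graphs and the choice of parameters *)

Lemma pinK_ge0 (R : realFieldType) (T : finType) (e : rel T) (rho : R) j U v :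
  0 <= rho -> 0 <= pinK e rho j U v.
Proof.
move=> rho0; elim: j U => [|j IHj] U /=; first by rewrite mulr_ge0 ?exprn_ge0.
by rewrite mulr_ge0 ?divr_ge0// sumr_ge0.
Qed.

(** Markov and a union bound in one test function [H], which is at least 1 on every graph violating
    one of the bounds. Its mean is at most [3 / n]: [n * 2 / n^2] from the exponential moments and
    [1 / n] from the weights [pinK]. *)
Lemma gnp_prob_ge_clusters (R : realType) n m (p r M theta rho : R)
    (a : pred {set {set 'I_n}}) :
  (0 < n)%N -> (m <= n)%N -> 0 <= p <= 1 -> 0 <= r <= 1 -> 0 <= theta -> 1 <= M <= 2 ->
  p * expR theta * (1 + r * (M - 1)) ^+ n + (1 - p) <= M ->
  (1 + r * 3) ^+ m <= 2 -> 0 < rho ->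
  (forall E : {set {set 'I_n}}, E \subset pairs n ->
     (forall u, bern setT p (fun O => expR theta ^+ #|cluster (adj E) O [set u]|)
                <= n%:R ^+ 2) ->
     (forall v, pinK (adj E) rho (n - m) setT v <= 12 * rho ^+ (n - m) * n%:R ^+ 2) ->
     a E) ->
  1 - 3 / n%:R <= gnp_prob r a.
Proof.
move=> n0 mn p01 r01 th0 /andP[M1 M2] HM Hm rho0 Ha; rewrite gnp_probE.
have nR : 0 < n%:R :> R by rewrite ltr0n.
have t1 : 1 <= expR theta by rewrite -expR0 ler_expR.
pose F u E := bern setT p (fun O => expR theta ^+ #|cluster (adj E) O [set u : 'I_n]|).
pose G v E := pinK (adj E) rho (n - m) [set: 'I_n] v.
pose c := 12 * rho ^+ (n - m) * n%:R ^+ 2.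
have c0 : 0 < c by rewrite !mulr_gt0 ?exprn_gt0.
have F0 u E : 0 <= F u E by apply: bern_ge0 => // O _; exact/exprn_ge0/expR_ge0.
have G0 v E : 0 <= G v E by apply: pinK_ge0; exact: ltW.
pose H E := (n%:R ^+ 2)^-1 * (\sum_u F u E) + c^-1 * (\sum_v G v E).
have SF E : 0 <= \sum_u F u E by apply: sumr_ge0.
have SG E : 0 <= \sum_v G v E by apply: sumr_ge0.
have H0 E : 0 <= H E.
  by rewrite addr_ge0// mulr_ge0// invr_ge0 ?exprn_ge0// ltW.
apply: (@le_trans _ _ (bern (pairs n) r (fun E => 1 + -1 * H E))); last first.
  apply: le_bern => // E EP; case aE: (a E); first by rewrite gerDl mulN1r oppr_le0.
  rewrite mulN1r subr_le0.
  have [u Hu|Fs] := pickP (fun u => n%:R ^+ 2 < F u E).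
    rewrite -[leLHS]addr0 lerD// ?mulr_ge0 ?invr_ge0 ?(ltW c0)//.
    rewrite ler_pdivlMl ?exprn_gt0// mulr1 (bigD1 u)//= -[leLHS]addr0 lerD ?(ltW Hu)//.
    exact: sumr_ge0.
  have [v Hv|Gs] := pickP (fun v => c < G v E).
    rewrite -[leLHS]add0r lerD// ?mulr_ge0 ?invr_ge0 ?exprn_ge0//.
    rewrite ler_pdivlMl// mulr1 (bigD1 v)//= -[leLHS]addr0 lerD ?(ltW Hv)//.
    exact: sumr_ge0.
  suff : a E by rewrite aE.
  by apply: Ha => // u; rewrite leNgt ?Fs// -/c -/(G u E) Gs.
rewrite bernD bern_cst bernZ mulN1r lerD2l lerN2 /H bernD !bernZ !bern_sum.
have hF : \sum_u bern (pairs n) r (F u) <= n%:R * 2.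
  apply: (@le_trans _ _ (\sum_(u < n) 2)); last by rewrite sumr_const card_ord mulr_natl.
  apply: ler_sum => u _.
  apply: le_trans (@bern_cluster_le _ n n setT [set u] p r (expR theta) M _ _ _ _ HM _) _ => //.
    by rewrite cardsT card_ord.
  by rewrite setIT cards1 expr1.
have hG : \sum_v bern (pairs n) r (G v) <= n%:R * (12 * rho ^+ (n - m)).
  apply: (@le_trans _ _ (\sum_(u < n) 12 * rho ^+ (n - m))); last first.
    by rewrite sumr_const card_ord -(mulr_natl (12 * _)).
  apply: ler_sum => v _; apply: (@bern_pinK_le _ n m) => //; first exact: ltW.
  by rewrite cardsT card_ord subnKC.
have -> : 3 / n%:R = (n%:R ^+ 2)^-1 * (n%:R * 2) + c^-1 * (n%:R * (12 * rho ^+ (n - m))).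
  by rewrite /c; field; rewrite expf_neq0 ?gt_eqF.
by apply: lerD; rewrite ler_wpM2l ?invr_ge0 ?exprn_ge0 ?(ltW c0).
Qed.

Lemma mixing_time_le_of_clusters (R : realType) n m (E : {set {set 'I_n}})
    (lam theta b : R) (p := lam / (1 + lam)) (eta := 3 / theta * ln n%:R)
    (rho := (1 - eta / m%:R)^-1) :
  E \subset pairs n -> 0 < lam -> lam <= 2^-1 -> 0 < theta ->
  (1 < n)%N -> (m <= n)%N -> 2 * eta <= m%:R -> n%:R <= b * m%:R -> 1 <= p * n%:R ->
  (forall u, bern setT p (fun O => expR theta ^+ #|cluster (adj E) O [set u]|)
             <= n%:R ^+ 2) ->
  (forall v, pinK (adj E) rho (n - m) setT v <= 12 * rho ^+ (n - m) * n%:R ^+ 2) ->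
  mixing_time_le E lam (12 * ((1 + lam) / lam + 3) * n%:R `^ (4 + 6 * b / theta)).
Proof.
move=> EP lam0 lam2 th0 n1 mn etam nb pn HF HG.
have nR : 1 < n%:R :> R by rewrite ltr1n.
have n0 : 0 < n%:R :> R by apply: lt_trans nR.
have ln0 : 0 < ln n%:R :> R by rewrite ln_gt0.
have eta0 : 0 < eta by rewrite !mulr_gt0// invr_gt0.
have m0 : 0 < m%:R :> R by apply: lt_le_trans etam; rewrite mulr_gt0.
have etalt : eta < m%:R by apply: lt_le_trans etam; rewrite ltr_pMl// ltr1n.
have l1 : 0 < 1 + lam by rewrite addr_gt0.
have p01 : 0 < p <= 1 by rewrite divr_gt0//= ler_pdivrMr// mul1r lerDr.
have nE : n%:R = expR (ln n%:R) :> R by rewrite lnK// posrE.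
have Heta u : 1 + bern (setT :\ u) p (fun O =>
      #|cluster (adj E) O (nbhd (adj E) u)|%:R) <= eta.
  apply: (mean_cluster_le p01 th0); apply: le_trans (HF u) _.
  (* Thus [expR (theta * eta)] is [n ^ 3]: one power of [n] more than the moment bound, to absorb
     [p] through [1 <= p * n]. *)
  have -> : theta * eta = ln n%:R * 3%:R by rewrite /eta; field; rewrite gt_eqF.
  by rewrite expRM_natr -nE (exprS _ 2) mulrA -[leLHS]mul1r ler_wpM2r ?exprn_ge0 ?(ltW n0).
pose c : R := 6 * b / theta; pose K : R := 12 * n%:R ^+ 2 * n%:R `^ c.
have b1 : 1 <= b.
  by rewrite -(ler_pM2r m0) mul1r; apply: le_trans nb; rewrite ler_nat.
have c0 : 0 <= c by rewrite divr_ge0 ?mulr_ge0 ?(ltW th0)//; lra.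
have x01 : 0 <= eta / m%:R <= 2^-1.
  by rewrite divr_ge0 ?(ltW eta0)//= ler_pdivrMr// ler_pdivlMl.
(* At most [n <= b m] factors, each at most [expR (2 eta / m)], give
   [expR (2 eta b) = n ^ (6 b / theta)]. *)
have rho_le : rho ^+ (n - m) <= n%:R `^ c.
  have rho0 : 0 <= rho.
    by rewrite invr_ge0; case/andP: x01 => _; lra.
  apply: (@le_trans _ _ (expR (2 * (eta / m%:R)) ^+ (n - m))).
    by rewrite lerXn2r ?nnegrE ?expR_ge0// inv1B_le_expR.
  rewrite -expRM_natr /powR gt_eqF// ler_expR.
  apply: (@le_trans _ _ (2 * (eta / m%:R) * n%:R)).
    apply: ler_wpM2l; first by rewrite mulr_ge0 ?divr_ge0 ?(ltW eta0).
    by rewrite ler_nat leq_subr.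
  apply: (@le_trans _ _ (2 * (eta / m%:R) * (b * m%:R))).
    by apply: ler_wpM2l; first by rewrite mulr_ge0 ?divr_ge0 ?(ltW eta0).
  rewrite le_eqVlt; apply/orP; left; apply/eqP; rewrite /c /eta; field.
  by rewrite !gt_eqF.
have HK v : pinK (adj E) rho (n - m) setT v <= K.
  apply: le_trans (HG v) _; rewrite /K -mulrA [leRHS]mulrAC -[leRHS]mulrA.
  by rewrite ler_wpM2l// ler_wpM2r ?exprn_ge0// ltW.
have poin := poincare_of_clusters EP lam0 lam2 mn eta0 etalt Heta HK.
have nc1 : 1 <= n%:R `^ c.
  by rewrite -[leLHS](powRr0 n%:R) ler_powR// ltW.
have n21 : 1 <= n%:R ^+ 2 :> R by rewrite exprn_ege1 ?(ltW nR).
have K1 : 1 <= K by rewrite /K; nra.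
have nK1 : 1 <= n%:R * K by rewrite mulr_ege1// ltW.
have nK0 : 0 < n%:R * K by apply: lt_le_trans nK1.
pose L := (1 + lam) / lam; have L0 : 0 < L by rewrite divr_gt0.
(* The term [n * L] beats the initial variance, at most [expR (n * L)]; the extra 2 leaves
   [expR (- 2) <= 1/4]. *)
pose s := n%:R * K * (n%:R * L + 2).
have s0 : 0 <= s by rewrite mulr_ge0 ?(ltW nK0)// addr_ge0// mulr_ge0 ?ltW.
have /andP[ts st] := truncn_itv s0; set t := (Num.truncn s).+1 in st.
exists t; split.
  apply: (@le_trans _ _ (s + 1)); first by rewrite -(natr1 (Num.truncn s)) lerD2r.
  have -> : 12 * (L + 3) * n%:R `^ (4 + c) = n%:R ^+ 2 * K * (L + 3).
    rewrite powRD; last by apply/implyP => _; rewrite gt_eqF.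
    by rewrite powR_mulrn ?(ltW n0)// /K; ring.
  have h1 : 1 <= n%:R ^+ 2 * K by rewrite mulr_ege1.
  have h2 : n%:R * K <= n%:R ^+ 2 * K.
    by rewrite expr2 -mulrA ler_peMl ?(ltW nR)// ltW.
  rewrite /s; have -> : n%:R * K * (n%:R * L + 2) = n%:R ^+ 2 * K * L + 2 * (n%:R * K) by ring.
  by rewrite mulrDr; lra.
move=> I0 iI0; apply: (tv_dist_glauber_le EP lam0 lam2 _ iI0 nK1 poin).
  exact: ltnW.
have g1 : (n%:R * K)^-1 <= 1 by rewrite invf_le1.
apply: (@le_trans _ _ (expR (- (n%:R * K)^-1 * t%:R) * expR (L * n%:R))).
  apply: ler_pM; rewrite ?exprn_ge0 ?subr_ge0 ?(ltW L0)//.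
    by apply: ler_1DX_expR; rewrite subr_ge0.
  rewrite expRM_natr lerXn2r ?nnegrE ?expR_ge0 ?(ltW L0)//.
  by apply: le_trans (expR_ge1Dx L); rewrite lerDr.
rewrite -expRD; apply: (@le_trans _ _ (expR (- 2))).
  rewrite ler_expR mulNr.
  have : n%:R * L + 2 <= (n%:R * K)^-1 * t%:R by rewrite ler_pdivlMl// ltW.
  by rewrite (mulrC L); lra.
rewrite expRN lef_pV2 ?posrE ?expR_gt0//.
have e1 : 2 <= expR 1 :> R by apply: le_trans (expR_ge1Dx 1); lra.
rewrite -[X in expR X]mul1r expRM_natr expr2.
have := ler_pM (ler0n _ 2) (ler0n _ 2) e1 e1; lra.
Qed.

From mathcomp Require Import all_classical all_reals all_analysis.

Theorem theoremL1 (R : realType) :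
  forall eps : R, 0 < eps ->
  exists d0 : R, 1 < d0 /\
  forall d : R, d0 < d ->
  exists C : R, 0 < C /\
  forall lam : R, 0 < lam -> lam <= (1 - eps) / d ->
  exists K : R, 0 < K /\
  forall delta : R, 0 < delta ->
  exists N : nat, forall n : nat, (N <= n)%N ->
    1 - delta <= gnp_prob (d / n%:R)
                   (fun E : {set {set 'I_n}} =>
                      `[< mixing_time_le E lam (K * (n%:R `^ C)) >]).
Proof.
move=> eps eps0.
pose y : R := Num.min eps 2^-1 / 2.
have y0 : 0 < y by rewrite divr_gt0 ?ltr0n// lt_min eps0 invr_gt0 ltr0n.
have yE : 2 * y = Num.min eps 2^-1 by rewrite /y mulrC divfK ?pnatr_eq0.
have y_eps : 2 * y <= eps by rewrite yE ge_min lexx.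
have y_half : 2 * y <= 2^-1 by rewrite yE ge_min lexx orbT.
have y1 : 0 < 1 - y by lra.
(* Solves the exploration recursion with [M = 1 + tau / d]: since [theta + tau = y], an open vertex
   costs at most [expR y <= 1 / (1 - y)], and [p * (1 / (1 - y) - 1) <= tau / d] because
   [p * d <= 1 - 2 y]. *)
pose tau : R := y * (1 - 2 * y) / (1 - y); pose theta := y - tau.
have tau0 : 0 < tau by rewrite divr_gt0// mulr_gt0//; lra.
have theta0 : 0 < theta.
  have -> : theta = y * y / (1 - y) by rewrite /theta /tau; field; rewrite gt_eqF.
  by rewrite divr_gt0// mulr_gt0.
(* [d > 2] forces [lam <= 1/2], as the crude Poincare inequality requires. *)
exists 2; split; first by rewrite ltr1n.
move=> d d2; have d0 : 0 < d by lra.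
exists (4 + 6 * (12 * d) / theta); split.
  by rewrite addr_gt0// divr_gt0// !mulr_gt0.
move=> lam lam0 lamd.
have lamd' : lam * d <= 1 - 2 * y.
  by rewrite -ler_pdivlMr//; apply: le_trans lamd _; rewrite ler_pM2r ?invr_gt0//; lra.
have lam2 : lam <= 2^-1.
  have : lam * 2 <= lam * d by rewrite ler_pM2l// ltW.
  lra.
pose L := (1 + lam) / lam; have L0 : 0 < L by rewrite divr_gt0 ?addr_gt0.
exists (12 * (L + 3)); split; first by rewrite mulr_gt0// addr_gt0.
move=> delta delta0.
(* The terms ensure, in order, [n <= 12 d m], [1 <= p * n] (as [p] is the inverse of [L]), failure
   probability at most [delta], and [2 eta <= m]. *)
pose B := 12 * d + L + 3 / delta + (2 * (72 * d / theta)) ^+ 2.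
have dl0 : 0 < 3 / delta by rewrite divr_gt0.
have sq0 : 0 <= (2 * (72 * d / theta)) ^+ 2 by exact: sqr_ge0.
exists (Num.truncn B).+1 => n Nn.
have Bn : B < n%:R by apply: lt_le_trans (truncnS_gt B) _; rewrite ler_nat.
have n12d : 12 * d < n%:R by rewrite /B in Bn; lra.
have nL : L <= n%:R by rewrite /B in Bn; lra.
have ndelta : 3 / delta <= n%:R by rewrite /B in Bn; lra.
have nsq : (2 * (72 * d / theta)) ^+ 2 <= n%:R by rewrite /B in Bn; lra.
have n1R : 1 < n%:R :> R by lra.
have n1 : (1 < n)%N by rewrite -(ltr1n R).
have nR0 : 0 < n%:R :> R by lra.
(* With [m <= n / (6 d)], one has [(1 + 3 d / n) ^ m <= expR (1/2) <= 2]. *)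
pose x := n%:R / (6 * d); have x0 : 0 <= x by rewrite divr_ge0// mulr_ge0// ltW.
have /andP[] := truncn_itv x0; set m := Num.truncn x; move=> mx xm.
have xE : 6 * d * x = n%:R by rewrite /x mulrC divfK// gt_eqF// mulr_gt0.
have mn : (m <= n)%N.
  rewrite -(ler_nat R); apply: le_trans mx _; rewrite -xE ler_peMl//; lra.
have nm : n%:R <= 12 * d * m%:R.
  rewrite -natr1 in xm; have : 6 * d * x <= 6 * d * (m%:R + 1).
    by rewrite ler_wpM2l ?mulr_ge0// ltW.
  rewrite xE; lra.
pose eta : R := 3 / theta * ln n%:R.
have etam : 2 * eta <= m%:R.
  have c0 : 0 <= 72 * d / theta by rewrite divr_ge0 ?mulr_ge0 ?ltW.
  have := ln_le_of_sqr_le c0 (ltW n1R) nsq.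
  have -> : 72 * d / theta * ln n%:R = 12 * d * (2 * eta) by rewrite /eta; ring.
  by move=> /le_trans /(_ nm); rewrite ler_pM2l// mulr_gt0.
have ln0 : 0 < ln n%:R :> R by rewrite ln_gt0.
have eta0 : 0 < eta by rewrite !mulr_gt0// invr_gt0.
have m0 : 0 < m%:R :> R by apply: lt_le_trans etam; rewrite mulr_gt0.
apply: (@le_trans _ _ (1 - 3 / n%:R)).
  by rewrite lerD2l lerN2 ler_pdivrMr// mulrC -ler_pdivrMr.
pose p := lam / (1 + lam).
have l1 : 0 < 1 + lam by rewrite addr_gt0.
have p01 : 0 <= p <= 1 by rewrite divr_ge0 ?(ltW l1) ?(ltW lam0)//= ler_pdivrMr// mul1r lerDr.
have plam : p <= lam by rewrite ler_pdivrMr// ler_peMr ?(ltW lam0)// lerDl ltW.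
have r01 : 0 <= d / n%:R <= 1.
  by rewrite divr_ge0 ?(ltW d0) ?(ltW nR0)//= ler_pdivrMr// mul1r; lra.
have taud0 : 0 < tau / d by rewrite divr_gt0.
apply: (@gnp_prob_ge_clusters R n m p (d / n%:R) (1 + tau / d) theta
   (1 - eta / m%:R)^-1) => //.
- exact: ltnW.
- exact: ltW.
- rewrite lerDl (ltW taud0)/= lerD2l ler_pdivrMr// mul1r.
  have : tau <= y by rewrite -subr_ge0 ltW.
  lra.
- have -> : d / n%:R * (1 + tau / d - 1) = tau / n%:R.
    by field; rewrite !gt_eqF.
  have tn : 0 <= tau / n%:R by rewrite divr_ge0 ?(ltW tau0) ?(ltW nR0).
  have e1 : (1 + tau / n%:R) ^+ n <= expR tau.
    have := @ler_1DX_expR R (tau / n%:R) n (addr_ge0 ler01 tn).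
    by rewrite divfK// gt_eqF.
  have e2 : expR theta * (1 + tau / n%:R) ^+ n <= (1 - y)^-1.
    apply: (@le_trans _ _ (expR theta * expR tau)); first by rewrite ler_wpM2l ?expR_ge0.
    by rewrite -expRD /theta subrK; apply: expR_le_inv1B; lra.
  have [p0 _] := andP p01.
  have h1 := ler_wpM2l p0 e2; rewrite mulrA in h1.
  have h2 : p * ((1 - y)^-1 - 1) <= tau / d.
    have -> : (1 - y)^-1 - 1 = y / (1 - y) by field; rewrite gt_eqF.
    rewrite ler_pdivlMr// mulrAC; apply: (@le_trans _ _ ((1 - 2 * y) * (y / (1 - y)))).
      apply: ler_wpM2r; first by rewrite divr_ge0 ?(ltW y0) ?(ltW y1).
      by apply: le_trans lamd'; rewrite ler_pM2r.
    by rewrite /tau mulrA (mulrC y).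
  lra.
- have [r0 _] := andP r01.
  apply: le_trans (@ler_1DX_expR R (d / n%:R * 3) m _) _; first by rewrite addr_ge0// mulr_ge0.
  have : d / n%:R * 3 * m%:R <= 2^-1.
    have -> : d / n%:R * 3 * m%:R = 3 * d * m%:R / n%:R by ring.
    rewrite ler_pdivrMr//; have : 6 * d * m%:R <= 6 * d * x.
      by rewrite ler_wpM2l ?mulr_ge0// ltW.
    rewrite xE; lra.
  rewrite -ler_expR => /le_trans -> //.
  apply: le_trans (@expR_le_inv1B R 2^-1 _) _; first by lra.
  by rewrite le_eqVlt; apply/orP; left; apply/eqP; field.
- rewrite invr_gt0 subr_gt0 ltr_pdivrMr// mul1r; apply: lt_le_trans etam.
  by rewrite ltr_pMl// ltr1n.
- move=> E EP HF HG; apply/asboolP.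
  apply: (mixing_time_le_of_clusters EP lam0 lam2 theta0 n1 mn etam nm) HF HG.
  have -> : lam / (1 + lam) = L^-1 by rewrite /L invf_div.
  by rewrite ler_pdivlMl// mulr1.
Qed.
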